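(* Let $\alpha,\beta,\gamma>-1$ (and $\sigma>0$ fixed). Then for every $f\in L^2(\Omega,w_{\alpha,\gamma},w_{\beta,\gamma})$ the Fourier orthogonal expansion of $f$ converges to $f$ in $L^2(\Omega,w_{\alpha,\gamma},w_{\beta,\gamma})$. Furthermore, for $f$ on $\Omega$ with $f(1,1)$ finite, $f(\cdot,1)\in L^2(w_{\alpha,\gamma})$ and $f(1,\cdot)\in L^2(w_{\beta,\gamma})$, and for all $n\ge0$, $$\begin{aligned}\|f-S_n^{\alpha,\beta,\gamma}f\|_{\alpha,\beta,\gamma}\le{}&c\left(\|f_1-s_n^{\alpha,\gamma}f_1\|_{L^2(w_{\alpha,\gamma})}+\|f_2-s_n^{\beta,\gamma}f_2\|_{L^2(w_{\beta,\gamma})}\right)\\&+c\left(\|g_1-s_n^{\alpha,\gamma+2}g_1\|_{L^2(w_{\alpha,\gamma+2})}+\|g_2-s_n^{\beta,\gamma+2}g_2\|_{L^2(w_{\beta,\gamma+2})}\right),\end{aligned}$$ where $c$ is a constant that depends only on $\alpha,\beta,\gamma$ and the fixed parameter $\sigma$, and $f_1(x)=f(x,1)$, $f_2(x)=f(1,x)$, $$g_1(x)=\frac{f(x,1)-f(1,1)}{1-x},\qquad g_2(y)=\frac{f(1,y)-f(1,1)}{1-y}.$$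
   Context: $\Omega=\{(x_1,1):x_1\in[0,1]\}\cup\{(1,x_2):x_2\in[0,1]\}$. $P_n^{(a,b)}$ is the usual Jacobi polynomial on $[-1,1]$ (orthogonal for $(1-t)^a(1+t)^b$, $P_n^{(a,b)}(1)=\binom{n+a}{n}$). $(a)_n=a(a+1)\cdots(a+n-1)$, $(a)_0=1$. $w_{\alpha,\gamma}(x)=x^\alpha(1-x)^\gamma$ on $[0,1]$, $c_{\alpha,\gamma}=\left(\int_0^1w_{\alpha,\gamma}\right)^{-1}$, $\|g\|_{L^2(v)}^2=\int_0^1|g|^2v\,dx$. The inner product is $$\langle f,g\rangle_{\alpha,\beta,\gamma}=c_{\alpha,\gamma}\int_0^1f(x,1)g(x,1)w_{\alpha,\gamma}(x)\,dx+\sigma c_{\beta,\gamma}\int_0^1f(1,y)g(1,y)w_{\beta,\gamma}(y)\,dy,$$ with norm $\|f\|_{\alpha,\beta,\gamma}=\|f\|_{L^2(\Omega,w_{\alpha,\gamma},w_{\beta,\gamma})}=\langle f,f\rangle_{\alpha,\beta,\gamma}^{1/2}$. $L^2(\Omega,w_{\alpha,\gamma},w_{\beta,\gamma})$ is the space of functions $f$ on $\Omega$ such that $f(1,1)$ is finite and this norm is finite. For $n\ge1$, $$P_n(x,y)=P_n^{(\gamma,\alpha)}(2x-1)+P_n^{(\gamma,\beta)}(2y-1)-\binom{n+\gamma}{n},$$ $$Q_n(x,y)=\frac{(\gamma+\alpha+2)_n}{(\alpha+1)_{n-1}}(1-x)P_{n-1}^{(\gamma+2,\alpha)}(2x-1)-\sigma^{-1}\frac{(\gamma+\beta+2)_n}{(\beta+1)_{n-1}}(1-y)P_{n-1}^{(\gamma+2,\beta)}(2y-1),$$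 $$R_n=Q_n-\frac{\langle P_n,Q_n\rangle_{\alpha,\beta,\gamma}}{\langle P_n,P_n\rangle_{\alpha,\beta,\gamma}}P_n .$$ The functions $1,P_n,R_n$ ($n\ge1$) are mutually orthogonal; the Fourier orthogonal expansion of $f$ is the expansion in them, with $n$-th partial sum $$S_n^{\alpha,\beta,\gamma}f=\frac{\langle f,1\rangle_{\alpha,\beta,\gamma}}{\langle1,1\rangle_{\alpha,\beta,\gamma}}+\sum_{k=1}^n\left[\frac{\langle f,P_k\rangle_{\alpha,\beta,\gamma}}{\langle P_k,P_k\rangle_{\alpha,\beta,\gamma}}P_k+\frac{\langle f,R_k\rangle_{\alpha,\beta,\gamma}}{\langle R_k,R_k\rangle_{\alpha,\beta,\gamma}}R_k\right].$$ $s_n^{\alpha,\gamma}g$ is the $n$-th partial sum (degrees $0$ to $n$) of the Fourier orthogonal expansion of $g\in L^2(w_{\alpha,\gamma})$ in the polynomials $P_k^{(\gamma,\alpha)}(2x-1)$, i.e. the $L^2(w_{\alpha,\gamma})$-orthogonal projection onto polynomials of degree at most $n$. *)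

(* Defs.v *)
From HB Require Import structures.
From mathcomp Require Import all_boot all_order all_algebra.
From mathcomp Require Import all_classical all_reals all_analysis.
From mathcomp Require Import ring.

Set Implicit Arguments.
Unset Strict Implicit.
Unset Printing Implicit Defensive.

Import Order.TTheory GRing.Theory Num.Theory.
Import numFieldNormedType.Exports.

Local Open Scope classical_set_scope.
Local Open Scope ring_scope.

Section Jacobi.
Context {R : realType}.
Implicit Types (a b : R) (n k : nat).

Definition poch a n : R := \prod_(i < n) (a + i%:R).

Definition gbinom a n : R := (\prod_(i < n) (a - i%:R)) / n`!%:R.

(* The Jacobi polynomial P_n^(a,b), by the expansion at t = 1 (Szego,
   Orthogonal Polynomials, (4.21.2)):
     sum_(k <= n) (n+a+b+1)_k (a+k+1)_(n-k) / (k! (n-k)!) * ((t-1)/2)^k.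
   This is (a+1)_n / n! * 2F1(-n, n+a+b+1; a+1; (1-t)/2) with the factor
   (a+1)_k cancelled. *)
Definition jacobi a b n : {poly R} :=
  \sum_(k < n.+1)
     (poch (n%:R + a + b + 1) k * poch (a + k%:R + 1) (n - k)
        / (k`!%:R * (n - k)`!%:R)) *: (2^-1 *: ('X - 1)) ^+ k.

Lemma jacobi_at1 a b n : (jacobi a b n).[1] = gbinom (n%:R + a) n.
Proof.
rewrite /jacobi horner_sum big_ord_recl big1 ?addr0; last first.
  by move=> i _; rewrite !hornerE subrr mulr0 expr0n /= mulr0.
rewrite hornerZ expr0 (hornerC 1) fact0 mulr1 mul1r subn0 /poch big_ord0 mul1r /gbinom.
congr (_ / _); rewrite (reindex_inj rev_ord_inj) /=; apply: eq_bigr => i _.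
by rewrite natrB ?ltn_ord // mulrS; ring.
Qed.

(* P_n^(a,b)(2x-1), the polynomial shifted to [0,1]. *)
Definition sjacobi a b n (x : R) : R := (jacobi a b n).[2 * x - 1].

End Jacobi.

Section OneVariable.
Context {R : realType}.
Implicit Types (alpha gamma : R) (v g h : R -> R).

Local Notation mu := (@lebesgue_measure R).
Local Notation I01 := (`[0%R, 1%R]%classic : set R).

Definition w alpha gamma (x : R) : R := x `^ alpha * (1 - x) `^ gamma.

Definition cw alpha gamma : R :=
  (\int[mu]_(x in I01) w alpha gamma x)^-1.

Definition in_L2 v g : Prop :=
  measurable_fun I01 g /\
  (\int[mu]_(x in I01) (`|g x| ^+ 2 * v x)%R%:E < +oo)%E.

Definition L2norm v g : R :=
  Num.sqrt (\int[mu]_(x in I01) (`|g x| ^+ 2 * v x)).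

Definition L2ip v g h : R := \int[mu]_(x in I01) (g x * h x * v x).

(* s_n^(alpha,gamma) g. The exponent gamma of 1 - x is the first Jacobi
   parameter. *)
Definition psum1 alpha gamma n g (x : R) : R :=
  let v := w alpha gamma in
  let p := sjacobi gamma alpha in
  \sum_(0 <= k < n.+1) L2ip v g (p k) / L2ip v (p k) (p k) * p k x.

End OneVariable.

(* Functions on Omega = [0,1] x {1} u {1} x [0,1] are represented by total
   functions on R * R; everything below depends only on their restriction to
   Omega. *)
Section Wedge.
Context {R : realType}.
Variables alpha beta gamma sigma : R.
Implicit Types f g : R * R -> R.

Local Notation mu := (@lebesgue_measure R).
Local Notation I01 := (`[0%R, 1%R]%classic : set R).

Definition ipO f g : R :=
  cw alpha gamma *
    \int[mu]_(x in I01) (f (x, 1) * g (x, 1) * w alpha gamma x) +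
  sigma * cw beta gamma *
    \int[mu]_(y in I01) (f (1, y) * g (1, y) * w beta gamma y).

Definition normO f : R := Num.sqrt (ipO f f).

(* The condition that the norm of f is finite uses integrals in \bar R, since
   the real-valued integral in ipO is 0 when the integral is infinite.
   Finiteness of f(1,1) holds because f is real-valued. *)
Definition in_L2O f : Prop :=
  [/\ measurable_fun I01 (fun x => f (x, 1)),
      measurable_fun I01 (fun y => f (1, y)) &
      ((cw alpha gamma)%R%:E *
         \int[mu]_(x in I01)
            (f (x, 1) * f (x, 1) * w alpha gamma x)%R%:E +
       (sigma * cw beta gamma)%R%:E *
         \int[mu]_(y in I01)
            (f (1, y) * f (1, y) * w beta gamma y)%R%:E < +oo)%E].

Definition oneO : R * R -> R := fun=> 1.

Definition PO n (p : R * R) : R :=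
  sjacobi gamma alpha n p.1 + sjacobi gamma beta n p.2
  - gbinom (n%:R + gamma) n.

(* Meaningful for n >= 1 only. *)
Definition QO n (p : R * R) : R :=
  poch (gamma + alpha + 2) n / poch (alpha + 1) n.-1
    * (1 - p.1) * sjacobi (gamma + 2) alpha n.-1 p.1
  - sigma^-1 * (poch (gamma + beta + 2) n / poch (beta + 1) n.-1)
    * (1 - p.2) * sjacobi (gamma + 2) beta n.-1 p.2.

Definition RO n (p : R * R) : R :=
  QO n p - ipO (PO n) (QO n) / ipO (PO n) (PO n) * PO n p.

Definition psumO n f (p : R * R) : R :=
  ipO f oneO / ipO oneO oneO +
  \sum_(1 <= k < n.+1)
     (ipO f (PO k) / ipO (PO k) (PO k) * PO k p +
      ipO f (RO k) / ipO (RO k) (RO k) * RO k p).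

End Wedge.

Section Traces.
Context {R : realType}.
Implicit Type f : R * R -> R.

Definition trace1 f (x : R) : R := f (x, 1).
Definition trace2 f (y : R) : R := f (1, y).

(* At the point 1 these take the value 0 / 0 = 0. *)
Definition quot1 f (x : R) : R := (f (x, 1) - f (1, 1)) / (1 - x).
Definition quot2 f (y : R) : R := (f (1, y) - f (1, 1)) / (1 - y).

End Traces.

(* Main.v *)
Require Import Defs.
From HB Require Import structures.
From mathcomp Require Import all_boot all_order all_algebra.
From mathcomp Require Import all_classical all_reals all_analysis.
From mathcomp Require Import measurable_realfun ring lra.

(** The functions [1], [P k], [R k] with [k <= n] span the pairs of polynomials of
    degree at most [n] on the two edges that agree at the corner.  Being mutually
    orthogonal, they make the partial sum the best approximation by such pairs
    ([psumO_best_approximation]).  So it is enough to find, on each edge separately,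
    a polynomial of degree at most [n] that takes the value [f (1, 1)] at the corner
    and is close to the restriction [F] of [f] ([edge_approximation]).

    Let [p_n] be the Jacobi polynomials of the edge, [s_n] the partial sums, and
    [G = (F - F 1) / (1 - x)].  The polynomial [F 1 + (1 - x) s_n G] has the right
    corner value, and its error is exactly that of [s_n G] because the square of
    [1 - x] is absorbed in the weight; but its degree is [n + 1].  Its component along
    [p_(n+1)] is controlled by its distance to [s_n F], hence by the two errors.  To
    remove this component without moving the corner value, subtract a multiple of
    [p_(n+1) - rho p_n] with [rho = p_(n+1)(1) / p_n(1)]; the cost is a constant
    factor because [p_n(1) ^ 2] divided by the squared norm of [p_n] grows by at most
    a constant factor at each step ([jnorm2_ratio]).

    Orthogonality of [P m] and [Q n] for [m < n] is a cancellation between the edges: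
    on each edge the pairing sees only the corner value of [P m], and the
    normalisation of [Q n] makes the coefficient independent of the exponent that
    differs ([L2ip_qpoly]).  This, the norms, and the orthogonality of Jacobi
    polynomials all come from one computation: Beta integrals with exponents
    differing by integers have rational ratios, so a moment of a Jacobi polynomial is
    an alternating binomial sum of a rational function with at most one pole
    ([jacobi_moment]), which finite differences evaluate ([fdiff_prod],
    [fdiff_prod_div]).

    Convergence follows from the error bound, since the quotients lie in the weighted
    space with [gamma + 2] and all four one-variable series converge.  The latter
    holds because polynomials are dense ([polynomials_dense_L2]): truncate, apply
    Lusin's theorem, and use Bernstein polynomials. *)

Set Implicit Arguments.
Unset Strict Implicit.
Unset Printing Implicit Defensive.

Import Order.TTheory GRing.Theory Num.Theory.
Import numFieldNormedType.Exports.

Local Open Scope classical_set_scope.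
Local Open Scope ring_scope.

(** * Rising factorials and finite differences *)

Section Poch.
Context {R : realType}.
Implicit Types (a b c : R) (n k : nat).

Lemma poch0 a : poch a 0 = 1.
Proof. by rewrite /poch big_ord0. Qed.

Lemma pochSr a n : poch a n.+1 = poch a n * (a + n%:R).
Proof. by rewrite /poch big_ord_recr. Qed.

Lemma pochSl a n : poch a n.+1 = a * poch (a + 1) n.
Proof.
rewrite /poch big_ord_recl addr0; congr (_ * _).
by apply: eq_bigr => i _; rewrite /bump /= natrD addrA.
Qed.

Lemma pochD a m n : poch a (m + n) = poch a m * poch (a + m%:R) n.
Proof.
elim: n => [|n IH]; first by rewrite addn0 poch0 mulr1.
by rewrite addnS !pochSr IH natrD addrA mulrA.
Qed.

Lemma poch_gt0 a n : 0 < a -> 0 < poch a n.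
Proof. by move=> a0; apply: prodr_gt0 => i _; rewrite ltr_wpDr. Qed.

Lemma gbinom_poch a n : gbinom (n%:R + a) n = poch (a + 1) n / n`!%:R.
Proof.
rewrite /gbinom; congr (_ / _); rewrite (reindex_inj rev_ord_inj) /poch /=.
by apply: eq_bigr => i _; rewrite natrB ?ltn_ord// mulrS; ring.
Qed.

End Poch.

Section FiniteDifferences.
Context {R : realType}.
Implicit Types (f g : nat -> R) (c : R) (k m n : nat) (s : seq R).

(** Up to sign the [k]-th difference of [f] at 0.  The recursion is the form that
    inductions use; the alternating binomial sum is [fdiffE]. *)
Fixpoint fdiff k f : R :=
  if k is k'.+1 then fdiff k' f - fdiff k' (fun j => f j.+1) else f 0%N.

Lemma fdiff_ext k f g : f =1 g -> fdiff k f = fdiff k g.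
Proof. by move=> fg; congr fdiff; apply/funext. Qed.

Lemma fdiffD k f g : fdiff k (fun j => f j + g j) = fdiff k f + fdiff k g.
Proof. by elim: k f g => //= k IH f g; rewrite !IH; ring. Qed.

Lemma fdiffZ k c f : fdiff k (fun j => c * f j) = c * fdiff k f.
Proof. by elim: k f => //= k IH f; rewrite !IH; ring. Qed.

Lemma fdiffE k f :
  fdiff k f = \sum_(j < k.+1) (-1) ^+ j * 'C(k, j)%:R * f j.
Proof.
elim: k f => [|k IH] f; first by rewrite big_ord1 /= expr0 !mul1r.
rewrite [LHS]/= !IH [RHS]big_ord_recl [X in X - _]big_ord_recl /= !bin0 -addrA.
congr (_ + _).
have -> : \sum_(i < k) (-1) ^+ bump 0 i * 'C(k, bump 0 i)%:R * f (bump 0 i) =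
  \sum_(i < k.+1) (-1) ^+ i.+1 * 'C(k, i.+1)%:R * f i.+1.
  by rewrite [RHS]big_ord_recr /= bin_small ?ltnSn// mulr0 mul0r addr0.
rewrite -sumrB; apply: eq_bigr => i _.
by rewrite /bump /= add1n binS natrD exprS; ring.
Qed.

Lemma fdiffS k f : fdiff k.+1 f = fdiff k f - fdiff k (fun j => f j.+1).
Proof. by []. Qed.

(** Leibniz rule for a factor whose second difference vanishes. *)
Lemma fdiff_mul_linear k c f :
  fdiff k.+1 (fun j => (c + j%:R) * f j) =
  c * fdiff k.+1 f - k.+1%:R * fdiff k (fun j => f j.+1).
Proof.
elim: k c f => [|k IH] c f; first by rewrite /=; ring.
have -> : fdiff k.+2 (fun j => (c + j%:R) * f j) =
    fdiff k.+1 (fun j => (c + j%:R) * f j) -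
    fdiff k.+1 (fun j => ((c + 1) + j%:R) * f j.+1).
  by rewrite fdiffS; congr (_ - _); apply: fdiff_ext => j; rewrite mulrS addrA.
by rewrite !IH !fdiffS (mulrS _ k.+1); ring.
Qed.

Lemma fdiff_cst k c : fdiff k.+1 (fun=> c) = 0.
Proof. by rewrite fdiffS subrr. Qed.

(** The product is a polynomial of degree less than [k] in [j]; the Leibniz rule
    lowers the order and the number of factors together. *)
Lemma fdiff_prod s k : (size s < k)%N ->
  fdiff k (fun j => \prod_(c <- s) (c + j%:R)) = 0.
Proof.
have [n sn] : {n | (size s <= n)%N} by exists (size s).
elim: n s k sn => [|n IH] [|c s] [|k] // sn sk.
- rewrite (@fdiff_ext _ _ (fun=> 1)) ?fdiff_cst// => j.
  by rewrite big_nil.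
- rewrite (@fdiff_ext _ _ (fun=> 1)) ?fdiff_cst// => j.
  by rewrite big_nil.
rewrite (@fdiff_ext _ _ (fun j => (c + j%:R) * \prod_(d <- s) (d + j%:R))).
  rewrite fdiff_mul_linear (IH s k.+1)//; last by rewrite ltnS ltnW.
  rewrite (@fdiff_ext _ _ (fun j => \prod_(d <- map (+%R 1) s) (d + j%:R))).
    by rewrite IH ?size_map// !mulr0 subr0.
  by move=> j; rewrite big_map; apply: eq_bigr => d _; rewrite mulrS addrCA addrA.
by move=> j; rewrite big_cons.
Qed.

Lemma fdiff_inv k c : 0 < c ->
  fdiff k (fun j => (c + j%:R)^-1) = k`!%:R / poch c k.+1.
Proof.
elim: k c => [|k IH] c c0; first by rewrite /= pochSr poch0 mul1r addr0 mul1r.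
rewrite fdiffS IH// (@fdiff_ext _ _ (fun j => ((c + 1) + j%:R)^-1)); last first.
  by move=> j; rewrite mulrS addrA.
have c1 : 0 < c + 1 by rewrite addr_gt0.
rewrite IH// pochSl [in RHS]pochSl [in RHS]pochSr (pochSr (c + 1) k) factS natrM.
have := poch_gt0 k c1; move: (poch (c + 1) k) => P P0.
have ck : 0 < c + 1 + k%:R by rewrite ltr_wpDr.
rewrite -[k.+1%:R]natr1.
by field; rewrite !gt_eqF.
Qed.

(** Dividing by [c + j] removes one factor up to a combination of lower
    products, which [fdiff] kills; what remains is the value of the product at
    [j = - c]. *)
Lemma fdiff_prod_div s k c : 0 < c -> (size s <= k)%N ->
  fdiff k (fun j => \prod_(d <- s) (d + j%:R) / (c + j%:R)) =
  \prod_(d <- s) (d - c) * (k`!%:R / poch c k.+1).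
Proof.
move=> c0; elim: s => [_|d s IH sk].
  rewrite big_nil mul1r -fdiff_inv//; apply: fdiff_ext => j.
  by rewrite big_nil mul1r.
rewrite (@fdiff_ext _ _ (fun j => \prod_(e <- s) (e + j%:R) +
  (d - c) * (\prod_(e <- s) (e + j%:R) / (c + j%:R)))).
  by rewrite fdiffD fdiffZ fdiff_prod// add0r IH ?(ltnW sk)// big_cons mulrA.
move=> j; rewrite big_cons.
have : c + j%:R != 0 by rewrite gt_eqF// ltr_wpDr.
by move=> h; field.
Qed.

End FiniteDifferences.

(** * Integrals of derivatives on the unit interval *)

Section Integration.
Context {R : realType}.
Local Notation mu := (@lebesgue_measure R).
Local Notation I01 := (`[0%R, 1%R]%classic : set R).
Local Notation O01 := (`]0%R, 1%R[%classic : set R).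
Implicit Types (f g F : R -> R) (D : set R).

Lemma integrableZ k f : mu.-integrable I01 (EFin \o f) ->
  mu.-integrable I01 (EFin \o (fun x => k * f x)).
Proof.
move=> fi; have := @integrableZl _ _ _ mu _ (measurable_itv _) k _ fi.
by apply: eq_integrable => // x _; rewrite /= EFinM.
Qed.

Lemma integrable_add f g :
  mu.-integrable I01 (EFin \o f) -> mu.-integrable I01 (EFin \o g) ->
  mu.-integrable I01 (EFin \o (fun x => f x + g x)).
Proof.
move=> fi gi; have := @integrableD _ _ _ mu _ (measurable_itv _) _ _ fi gi.
by apply: eq_integrable => // x _; rewrite /= EFinD.
Qed.

Lemma Rintegral_lincomb (I : Type) (r : seq I) (c : I -> R) (u : I -> R -> R) :
  (forall i, mu.-integrable I01 (EFin \o u i)) ->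
  mu.-integrable I01 (EFin \o (fun x => \sum_(i <- r) c i * u i x)) /\
  \int[mu]_(x in I01) (\sum_(i <- r) c i * u i x) =
  \sum_(i <- r) c i * \int[mu]_(x in I01) u i x.
Proof.
move=> ui; elim: r => [|i r [IH1 IH2]].
  rewrite big_nil; split.
    by apply: eq_integrable (integrable0 _ _) => // x _; rewrite /= big_nil.
  under eq_Rintegral do rewrite big_nil.
  by rewrite Rintegral_cst// mul0r.
have iZ := integrableZ (c i) (ui i); split.
  have := integrable_add iZ IH1.
  by apply: eq_integrable => // x _; rewrite /= big_cons.
under eq_Rintegral do rewrite big_cons.
by rewrite RintegralD// RintegralZl// IH2 big_cons.
Qed.

Lemma Rintegral_dominated_cvg D (u : nat -> R -> R) (l g : R -> R) :
  measurable D -> (forall n, measurable_fun D (u n)) ->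
  mu.-integrable D (EFin \o g) ->
  (forall n x, D x -> `|u n x| <= g x) ->
  (forall x, D x -> u n x @[n --> \oo] --> l x) ->
  \int[mu]_(x in D) u n x @[n --> \oo] --> \int[mu]_(x in D) l x.
Proof.
move=> mD mu_ ig ug ul.
have ml : measurable_fun D (EFin \o l).
  apply: (emeasurable_fun_cvg (fun n => EFin \o u n)) => [n|x Dx].
    exact/measurable_EFinP.
  by apply: cvg_EFin; [exact: nearW|exact: ul].
have [||||| il _ cl] := @dominated_convergence _ _ _ mu _ mD
  (fun n => EFin \o u n) (EFin \o l) (EFin \o g).
- move=> n; apply/measurable_EFinP; exact: mu_.
- exact: ml.
- by apply/aeW => x Dx /=; apply: cvg_EFin; [exact: nearW|exact: ul].
- exact: ig.
- by apply/aeW => x n Dx /=; rewrite lee_fin ug.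
rewrite /Rintegral; apply: fine_cvg.
rewrite fineK; last exact: integrable_fin_num.
exact: cl.
Qed.

(* The factor 1/3 makes [en n < 1 - en n] hold already at [n = 0]. *)
Let en (n : nat) : R := 3^-1 * harmonic n.
Let In n := `[en n, 1 - en n]%classic : set R.

Let en_gt0 n : 0 < en n.
Proof. by rewrite /en mulr_gt0 ?harmonic_gt0. Qed.

Let en_le3 n : en n <= 3^-1.
Proof.
by rewrite /en /= ler_piMr// invf_le1 ?ler1n// ltr0n.
Qed.

Let en_lt n : en n < 1 - en n.
Proof. by have := en_le3 n; lra. Qed.

Let en_cvg : en n @[n --> \oo] --> (0 : R).
Proof. by rewrite -[X in _ --> X](mulr0 3^-1); apply: cvgMr; exact: cvg_harmonic. Qed.

Let en_lt1 n : 1 - en n < 1.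
Proof. by have := en_gt0 n; lra. Qed.

Let cvg_1en : 1 - en n @[n --> \oo] --> (1 : R).
Proof. by rewrite -[X in _ --> X]subr0; apply: cvgB; [exact: cvg_cst|exact: en_cvg]. Qed.

Let In_mono : {homo In : n m / (n <= m)%N >-> (n <= m)%O}.
Proof.
move=> n m nm; rewrite subsetEset => x; rewrite /In /= !in_itv /= => /andP[h1 h2].
suff : en m <= en n by move=> h; apply/andP; split; lra.
by rewrite /en /= ler_pM2l ?invr_gt0// lef_pV2 ?posrE ?ltr0n// ler_nat ltnS.
Qed.

Let near_In (x : R) : 0 < x < 1 -> \forall n \near \oo, In n x.
Proof.
move=> /andP[x0 x1]; have h := en_cvg.
have h1 : \forall n \near \oo, en n < x.
  by apply: (cvgr_lt 0 h).
have h2 : \forall n \near \oo, en n < 1 - x.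
  by apply: (cvgr_lt 0 h); rewrite subr_gt0.
near=> n; rewrite /In /= in_itv /=; apply/andP; split; first by apply: ltW; near: n.
have : en n < 1 - x by near: n.
by lra.
Unshelve. all: by end_near. Qed.

Let bigcup_In : \bigcup_n In n = O01.
Proof.
apply/seteqP; split=> x /=.
  move=> [n _]; rewrite /In /= !in_itv /= => /andP[h1 h2].
  by have := en_gt0 n => h3; apply/andP; split; lra.
rewrite in_itv /= => /near_In [n _ /(_ n (leqnn n))] h.
by exists n.
Qed.

Variables (f F : R -> R).
Hypothesis dF : forall x : R, 0 < x < 1 -> is_derive x 1 F (f x).
Hypothesis cf : forall x : R, 0 < x < 1 -> {for x, continuous f}.

Let FTC_In n : (\int[mu]_(x in In n) (f x)%:E = (F (1 - en n) - F (en n))%:E)%E.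
Proof.
have sub (x : R) : x \in `[en n, 1 - en n] -> 0 < x < 1.
  by rewrite in_itv /= => /andP[? ?]; have := en_gt0 n => ?; apply/andP; split; lra.
have subo (x : R) : x \in `]en n, 1 - en n[ -> 0 < x < 1.
  by move=> h; apply: sub; exact: subset_itv_oo_cc h.
have cF (x : R) : 0 < x < 1 -> {for x, continuous F}.
  move=> /dF [dx _]; apply: differentiable_continuous; exact/derivable1_diffP.
have en_in : 0 < en n < 1.
  by have := en_gt0 n; have := en_le3 n => ? ?; apply/andP; split; lra.
have en1_in : 0 < 1 - en n < 1.
  by have := en_gt0 n; have := en_le3 n => ? ?; apply/andP; split; lra.
rewrite EFinB; apply: continuous_FTC2.
- exact: en_lt.
- by apply: continuous_in_subspaceT => x /set_mem /= /sub; exact: cf.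
- split=> [x /subo/dF[]//||].
    exact/cvg_at_right_filter/cF.
  exact/cvg_at_left_filter/cF.
- by move=> x /subo/dF h; rewrite derive1E derive_val.
Qed.

Let mf : measurable_fun O01 f.
Proof.
apply: open_continuous_measurable_fun; first exact: interval_open.
by move=> x /set_mem /=; rewrite in_itv /=; exact: cf.
Qed.

Let InS n : In n `<=` O01.
Proof. by rewrite -bigcup_In => x ?; exists n. Qed.

Let mfI : measurable_fun I01 f.
Proof. exact: measurable_fun_itv_cc mf. Qed.

Let ooE (h : R -> R) : measurable_fun O01 h ->
  (\int[mu]_(x in I01) (h x)%:E = \int[mu]_(x in `]0%R, 1%R[) (h x)%:E)%E.
Proof.
move=> mh; rewrite -integral_itv_bndo_bndc; last first.
  exact/measurable_EFinP/measurable_fun_itv_obnd_cbndP.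
by rewrite -integral_itv_obnd_cbnd//; exact/measurable_EFinP.
Qed.

(** Monotone convergence along [In n]: a bounded primitive suffices, although [f]
    may blow up at both endpoints. *)
Lemma integrable_derivative_ge0 M : (forall x : R, 0 < x < 1 -> 0 <= f x) ->
  (forall x : R, 0 < x < 1 -> `|F x| <= M) -> mu.-integrable I01 (EFin \o f).
Proof.
move=> f0 FM; apply/integrableP; split; first exact/measurable_EFinP.
have -> : (\int[mu]_(x in I01) `|(f x)%:E| = \int[mu]_(x in `]0%R, 1%R[) (f x)%:E)%E.
  rewrite (ooE (h := fun x => `|f x|)); last exact: measurableT_comp.
  by apply: eq_integral => x /set_mem /=; rewrite in_itv /= => /f0 /ger0_norm ->.
rewrite -bigcup_In.
have mfn n : measurable_fun (In n) (EFin \o f).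
  by apply/measurable_EFinP; apply: measurable_funS mf => //; exact: InS.
have fn0 n x : In n x -> (0 <= (EFin \o f) x)%E.
  by move=> /InS /=; rewrite in_itv /= lee_fin; exact: f0.
have h := ge0_nondecreasing_set_cvg_integral (mu := mu) In_mono
  (fun=> measurable_itv _) mfn fn0.
apply: (@le_lt_trans _ _ (M + M)%:E); last exact: ltry.
rewrite -(cvg_lim _ h)//; apply: lime_le; first by apply/cvg_ex; eexists; exact: h.
apply: nearW => n; rewrite FTC_In lee_fin.
have e0 := en_gt0 n; have e3 := en_le3 n.
apply: (le_trans (ler_norm _)); apply: (le_trans (ler_normB _ _)).
by apply: lerD; apply: FM; apply/andP; split; lra.
Qed.

(** The truncations of [f] to [In n], where the classical theorem applies, are
    dominated by [`|f|]. *)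
Lemma Rintegral_derivative (l0 l1 : R) : mu.-integrable I01 (EFin \o f) ->
  F x @[x --> 0^'+] --> l0 -> F x @[x --> 1^'-] --> l1 ->
  \int[mu]_(x in I01) f x = l1 - l0.
Proof.
move=> fi F0 F1.
have fio : mu.-integrable O01 (EFin \o f).
  by apply: integrableS fi => //; exact: subset_itv_oo_cc.
have cl : \int[mu]_(x in `]0%R, 1%R[) (f \_ (In n)) x @[n --> \oo] -->
    \int[mu]_(x in `]0%R, 1%R[) f x.
  apply: (@Rintegral_dominated_cvg _ _ _ (fun x => `|f x|)) => //.
  - move=> n; apply/(measurable_restrict f (measurable_itv _) (measurable_itv _)).
    by apply: (measurable_funS _ _ mf) => // x [].
  - exact: integrable_norm.
  - move=> n x _; rewrite /patch; case: ifP => // _.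
    by rewrite normr0.
  - move=> x /=; rewrite in_itv /= => /near_In h.
    apply: cvg_near_cst; apply: filterS h => n Inx.
    by rewrite /patch mem_set.
have cr : \int[mu]_(x in `]0%R, 1%R[) (f \_ (In n)) x @[n --> \oo] --> l1 - l0.
  have -> : (fun n => \int[mu]_(x in `]0%R, 1%R[) (f \_ (In n)) x) =
      (fun n => F (1 - en n) - F (en n)).
    apply/funext => n; rewrite -Rintegral_mkcondr setIidr; last exact: InS.
    by rewrite /Rintegral FTC_In.
  apply: cvgB.
    by move/cvg_at_leftP : F1; apply; split => [n|]; [exact: en_lt1|exact: cvg_1en].
  by move/cvg_at_rightP : F0; apply; split => [n|]; [exact: en_gt0|exact: en_cvg].
rewrite {1}/Rintegral ooE//.
by apply: cvg_unique cl cr.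
Qed.

End Integration.

(** * Beta integrals *)

Section Weight.
Context {R : realType}.
Local Notation mu := (@lebesgue_measure R).
Local Notation I01 := (`[0%R, 1%R]%classic : set R).
Implicit Types (a b p x : R) (n : nat).

Definition beta_int b a : R := \int[mu]_(x in I01) w b a x.

Lemma w_ge0 b a x : 0 <= w b a x.
Proof. by rewrite mulr_ge0 ?powR_ge0. Qed.

Lemma measurable_w b a : measurable_fun I01 (w b a).
Proof.
apply: measurable_funTS; apply: measurable_funM; first exact: measurable_powR.
have m1 : measurable_fun [set: R] (fun x : R => 1 - x) by exact: measurable_funB.
exact: (measurableT_comp (measurable_powR a) m1).
Qed.

(** At [x = 0] the point is that [p + n] is not zero unless [n] is, so that the
    convention for [0 `^ 0] does no harm. *)
Lemma powR_shift p x n : -1 < p -> 0 <= x -> x `^ (p + n%:R) = x `^ p * x ^+ n.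
Proof.
move=> p1 x0; case: n => [|n]; first by rewrite addr0 expr0 mulr1.
rewrite powRD ?powR_mulrn//; apply/implyP => /eqP h; exfalso; move: h.
by have := ler0n R n; rewrite mulrS; lra.
Qed.

Lemma w_shift b a n x : -1 < a -> x <= 1 ->
  w b (a + n%:R) x = w b a x * (1 - x) ^+ n.
Proof. by move=> a1 x1; rewrite /w powR_shift ?subr_ge0// mulrA. Qed.

Lemma is_derive_powR_onem p x : x < 1 ->
  is_derive x 1 (fun x => (1 - x) `^ p) (- (p * (1 - x) `^ (p - 1))).
Proof.
move=> x1; have x1' : 0 < 1 - x by rewrite subr_gt0.
have d := is_derive1_powR p x1'.
have := @is_derive1_comp R (fun y : R => y `^ p) (fun x => 1 - x) x _ (-1) d.
rewrite /comp => h; apply: is_derive_eq.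
  by apply: h; apply: is_derive_eq; ring.
by rewrite mulrN1.
Qed.

Lemma powR_half_bound p x : 2^-1 <= x <= 1 -> x `^ p <= ((2^-1) `^ `|p|)^-1.
Proof.
move=> /andP[x2 x1]; have x0 : 0 < x by apply: lt_le_trans x2; rewrite invr_gt0.
apply: (@le_trans _ _ (x `^ (- `|p|))).
  apply: ger_powR; rewrite ?x0//.
  by have := ler_norm (- p); rewrite normrN => ?; lra.
rewrite powRN lef_pV2 ?posrE ?powR_gt0//.
by apply: ge0_ler_powR; rewrite ?nnegrE ?invr_ge0 ?(ltW x0).
Qed.

Let c01 x : x \in `[0, 1] -> 0 <= x <= 1. Proof. by rewrite in_itv. Qed.

Let continuous_powR_in p x : 0 < x -> {for x, continuous (fun y : R => y `^ p)}.
Proof.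
move=> x0; apply: differentiable_continuous; apply/derivable1_diffP.
by have [] := is_derive1_powR p x0.
Qed.

Let continuous_onem_in p x : x < 1 -> {for x, continuous (fun x : R => (1 - x) `^ p)}.
Proof.
move=> x0; apply: differentiable_continuous; apply/derivable1_diffP.
by have [] := is_derive_powR_onem p x0.
Qed.

(** The primitive below is bounded because both exponents exceed [-1]. *)
Let integrable_powRD b a : -1 < b -> -1 < a ->
  mu.-integrable I01 (EFin \o (fun x => x `^ b + (1 - x) `^ a)).
Proof.
move=> b1 a1; have b0 : 0 < b + 1 by lra.
have a0 : 0 < a + 1 by lra.
pose F x := (b + 1)^-1 * x `^ (b + 1) - (a + 1)^-1 * (1 - x) `^ (a + 1).
apply: (@integrable_derivative_ge0 _ _ F _ _ ((b + 1)^-1 + (a + 1)^-1)).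
- move=> x /andP[x0 x1].
  have d1 := is_derive1_powR (b + 1) x0.
  have d2 := is_derive_powR_onem (a + 1) x1.
  apply: is_derive_eq.
  rewrite !addrK /GRing.scale /=.
  by field; rewrite !gt_eqF.
- move=> x /andP[x0 x1]; apply: continuousD.
    exact: continuous_powR_in.
  exact: continuous_onem_in.
- by move=> x _; rewrite addr_ge0// powR_ge0.
- move=> x /andP[x0 x1]; apply: le_trans (ler_normB _ _) _.
  have bnd (y p : R) : 0 <= y <= 1 -> 0 < p -> `|p^-1 * y `^ p| <= p^-1.
    move=> /andP[y0 y1] p0; rewrite ger0_norm ?mulr_ge0 ?powR_ge0 ?invr_ge0 ?(ltW p0)//.
    rewrite ler_piMr ?invr_ge0 ?(ltW p0)//.
    have -> : 1 = 1 `^ p :> R by rewrite powR1.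
    by apply: ge0_ler_powR; rewrite ?nnegrE ?ler01 ?(ltW p0).
  by apply: lerD; apply: bnd => //; apply/andP; split; lra.
Qed.

(** Each of the two factors is bounded away from its own singularity, so the sum
    of the two powers dominates their product. *)
Lemma integrable_w b a : -1 < b -> -1 < a -> mu.-integrable I01 (EFin \o w b a).
Proof.
move=> b1 a1.
pose Ka : R := ((2^-1) `^ `|a|)^-1; pose Kb : R := ((2^-1) `^ `|b|)^-1.
have Ka0 : 0 <= Ka by rewrite invr_ge0 powR_ge0.
have Kb0 : 0 <= Kb by rewrite invr_ge0 powR_ge0.
have ig : mu.-integrable I01
    (EFin \o (fun x => (Ka + Kb) * (x `^ b + (1 - x) `^ a))).
  exact: integrableZ (integrable_powRD b1 a1).
apply: (le_integrable _ _ _ ig) => //.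
- apply/measurable_EFinP; exact: measurable_w.
- move=> x /= /c01 /andP[x0 x1]; rewrite lee_fin.
  rewrite ger0_norm ?w_ge0// ger0_norm; last first.
    by rewrite mulr_ge0 ?addr_ge0 ?powR_ge0.
  have pb := powR_ge0 x b; have pa := powR_ge0 (1 - x) a.
  rewrite /w; have [x2|x2] := leP x 2^-1.
    have : (1 - x) `^ a <= Ka by apply: powR_half_bound; apply/andP; split; lra.
    by move=> h; nra.
  have : x `^ b <= Kb by apply: powR_half_bound; apply/andP; split; lra.
  by move=> h; nra.
Qed.

(** Integrate the derivative of [x `^ (b + 1) * (1 - x) `^ (a + 1)], which
    vanishes at both ends. *)
Lemma beta_int_rec b a : -1 < b -> -1 < a ->
  (a + b + 2) * beta_int b (a + 1) = (a + 1) * beta_int b a.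
Proof.
move=> b1 a1; have b0 : 0 < b + 1 by lra.
have a0 : 0 < a + 1 by lra.
have ib : mu.-integrable I01 (EFin \o w b (a + 1)) by apply: integrable_w => //; lra.
have ia : mu.-integrable I01 (EFin \o w (b + 1) a) by apply: integrable_w => //; lra.
have i0 := integrable_w b1 a1.
have ib' : mu.-integrable I01 (EFin \o (fun x => (b + 1) * w b (a + 1) x)).
  exact: integrableZ ib.
have ia' : mu.-integrable I01 (EFin \o (fun x => (a + 1) * w (b + 1) a x)).
  exact: integrableZ ia.
have e1 : beta_int (b + 1) a = beta_int b a - beta_int b (a + 1).
  rewrite /beta_int -RintegralB//; apply: eq_Rintegral => x /set_mem /= /c01 /andP[x0 x1].
  rewrite (w_shift b 1 a1 x1) /w (powR_shift 1 b1 x0) !expr1; ring.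
have e2 : (b + 1) * beta_int b (a + 1) - (a + 1) * beta_int (b + 1) a = 0.
  rewrite /beta_int -!RintegralZl// -RintegralB//.
  pose F (x : R) := x `^ (b + 1) * (1 - x) `^ (a + 1).
  rewrite -[RHS](subrr 0).
  apply: (@Rintegral_derivative _ _ F).
  - move=> x /andP[x0 x1].
    have d1 := is_derive1_powR (b + 1) x0.
    have d2 := is_derive_powR_onem (a + 1) x1.
    apply: is_derive_eq; rewrite !addrK /GRing.scale /w /=.
    by ring.
  - move=> x /andP[x0 x1].
    have c1 := continuous_powR_in (p := b) x0.
    have c2 := continuous_powR_in (p := b + 1) x0.
    have c3 := continuous_onem_in (p := a) x1.
    have c4 := continuous_onem_in (p := a + 1) x1.
    by apply: continuousB; apply: continuousM => //; try exact: cvg_cst; apply: continuousM.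
  - have := integrable_add ib' (integrableZ (-1) ia').
    by apply: eq_integrable => // x _; rewrite /= mulN1r.
  - rewrite -[X in _ --> X](mul0r ((1 - 0) `^ (a + 1))); apply: cvgM.
      exact: powR_cvg0.
    by apply: cvg_at_right_filter; apply: continuous_onem_in.
  - rewrite -[X in _ --> X](mulr0 (1 `^ (b + 1))); apply: cvgM.
      by apply: cvg_at_left_filter; apply: continuous_powR_in.
    apply/cvg_at_leftP => u [u1 cu].
    have /cvg_at_rightP := powR_cvg0 a0; apply; split => [n|].
      by rewrite subr_gt0.
    by rewrite -[X in _ --> X](subrr (1 : R)); apply: cvgB => //; exact: cvg_cst.
move: e2; rewrite e1; clear; move: (beta_int b a) (beta_int b (a + 1)) => B B'.
by lra.
Qed.

Lemma beta_int_gt0 b a : -1 < b -> -1 < a -> 0 < beta_int b a.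
Proof.
move=> b1 a1; rewrite lt_def; apply/andP; split; last first.
  by apply: Rintegral_ge0 => x _; exact: w_ge0.
apply/eqP => h.
have h0 : (\int[mu]_(x in I01) `|(w b a x)%:E| = 0)%E.
  transitivity (\int[mu]_(x in I01) (w b a x)%:E)%E.
    by apply: eq_integral => x _; rewrite gee0_abs// lee_fin w_ge0.
  rewrite -[LHS]fineK ?integrable_fin_num//; last exact: integrable_w.
  by rewrite -/(Rintegral _ _ _) -/(beta_int b a) h.
have mw : measurable_fun I01 (EFin \o w b a).
  by apply/measurable_EFinP; exact: measurable_w.
have /(ae_eq_integral_abs mu (measurable_itv _) mw) [N [mN N0 subN]] := h0.
have sub : (`]0%R, 1%R[%classic : set R) `<=` N.
  move=> x; rewrite /= in_itv /= => /andP[x0 x1]; apply: subN => /= hx.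
  have : (w b a x)%:E = 0%E.
    by apply: hx; rewrite in_itv /= !ltW.
  by move=> [] /eqP; rewrite gt_eqF// mulr_gt0// powR_gt0// subr_gt0.
have : (mu (`]0%R, 1%R[%classic : set R) <= mu N)%E by apply: le_measure; rewrite ?inE.
by rewrite N0 lebesgue_measure_itv /= lte_fin ltr01 sube0 lee_fin ler10.
Qed.

Lemma beta_int_shift b a n : -1 < b -> -1 < a ->
  beta_int b (a + n%:R) =
  beta_int b a * (poch (a + 1) n / poch (a + b + 2) n).
Proof.
move=> b1 a1; elim: n => [|n IH]; first by rewrite addr0 !poch0 divr1 mulr1.
have n0 := ler0n R n.
have an : -1 < a + n%:R by lra.
have s0 : 0 < a + b + 2 by lra.
have sn : 0 < a + b + 2 + n%:R by lra.
have sn0 : a + n%:R + b + 2 != 0 by rewrite gt_eqF//; lra.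
have P0 := poch_gt0 n s0.
have := beta_int_rec b1 an; rewrite IH !pochSr.
rewrite -[n.+1%:R]natr1 [a + (_ + 1)]addrA => e.
by apply: (mulfI sn0); rewrite e; field; rewrite !gt_eqF.
Qed.

End Weight.

(** * Moments of Jacobi polynomials *)

Section JacobiMoments.
Context {R : realType}.
Local Notation mu := (@lebesgue_measure R).
Local Notation I01 := (`[0%R, 1%R]%classic : set R).
Implicit Types (a b c d e x : R) (i j k m n : nat).

Definition jcoef a b n k : R :=
  poch (n%:R + a + b + 1) k * poch (a + k%:R + 1) (n - k)
    / (k`!%:R * (n - k)`!%:R).

Definition sjpoly a b n : {poly R} :=
  \sum_(k < n.+1) jcoef a b n k *: ('X - 1) ^+ k.

Lemma horner_sjpoly a b n x : (sjpoly a b n).[x] = sjacobi a b n x.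
Proof.
rewrite /sjpoly /sjacobi /jacobi !horner_sum; apply: eq_bigr => k _.
rewrite !hornerZ !horner_exp !hornerE; congr (_ * _ ^+ _).
by field.
Qed.

Lemma sjacobiE a b n x : sjacobi a b n x =
  \sum_(k < n.+1) (-1) ^+ k * jcoef a b n k * (1 - x) ^+ k.
Proof.
rewrite -horner_sjpoly /sjpoly horner_sum; apply: eq_bigr => k _.
rewrite hornerZ horner_exp.
have -> : ('X - 1 : {poly R}).[x] = - 1 * (1 - x) by rewrite !hornerE; ring.
by rewrite exprMn mulrCA mulrA.
Qed.

Lemma sjacobi1 a b n : sjacobi a b n 1 = gbinom (n%:R + a) n.
Proof. by rewrite /sjacobi -(jacobi_at1 a b n) mulr1; congr (_.[_]); lra. Qed.

Lemma jcoef_bin a b n k : -1 < a -> (k <= n)%N ->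
  jcoef a b n k = poch (a + 1) n / n`!%:R *
    ('C(n, k)%:R * (poch (n%:R + a + b + 1) k / poch (a + 1) k)).
Proof.
move=> a1 kn; have a0 : 0 < a + 1 by lra.
have := pochD (a + 1) k (n - k); rewrite subnKC// => ->.
rewrite -(bin_fact kn) !natrM.
have := poch_gt0 k a0.
have k0 : 0 < k`!%:R :> R by rewrite ltr0n fact_gt0.
have nk0 : 0 < (n - k)`!%:R :> R by rewrite ltr0n fact_gt0.
have b0 : 0 < 'C(n, k)%:R :> R by rewrite ltr0n bin_gt0.
move=> P0; rewrite /jcoef (_ : a + k%:R + 1 = a + 1 + k%:R); last by ring.
by field; rewrite !gt_eqF.
Qed.

(** Integrating term by term against a Beta weight turns a Jacobi polynomial
    into an alternating binomial sum of a ratio of rising factorials. *)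
Lemma jacobi_moment a b e n : -1 < a -> -1 < b -> -1 < e ->
  \int[mu]_(x in I01) (sjacobi a b n x * w b e x) =
  beta_int b e * (poch (a + 1) n / n`!%:R) *
  fdiff n (fun k => poch (n%:R + a + b + 1) k * poch (e + 1) k /
                    (poch (a + 1) k * poch (e + b + 2) k)).
Proof.
move=> a1 b1 e1.
transitivity (\sum_(k < n.+1) (-1) ^+ k * jcoef a b n k * beta_int b (e + k%:R)).
  transitivity (\int[mu]_(x in I01)
      \sum_(k < n.+1) ((-1) ^+ k * jcoef a b n k) * w b (e + k%:R) x).
    apply: eq_Rintegral => x /set_mem /=; rewrite in_itv /= => /andP[_ x1].
    rewrite sjacobiE mulr_suml; apply: eq_bigr => k _.
    by rewrite (w_shift b k e1 x1); ring.
  have ui (k : 'I_n.+1) : mu.-integrable I01 (EFin \o w b (e + k%:R)).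
    by apply: integrable_w => //; have := ler0n R k; lra.
  by have [_ ->] := Rintegral_lincomb (index_enum _)
    (fun k : 'I_n.+1 => (-1) ^+ k * jcoef a b n k) ui.
rewrite fdiffE mulr_sumr; apply: eq_bigr => k _.
rewrite beta_int_shift// jcoef_bin//; last by rewrite -ltnS.
have A0 : 0 < poch (a + 1) k by apply: poch_gt0; lra.
have E0 : 0 < poch (e + b + 2) k by apply: poch_gt0; lra.
have F0 : 0 < n`!%:R :> R by rewrite ltr0n fact_gt0.
by field; rewrite !gt_eqF.
Qed.

Definition pochs a m : seq R := [seq a + i%:R | i <- iota 0 m].

Lemma size_pochs a m : size (pochs a m) = m.
Proof. by rewrite size_map size_iota. Qed.

Lemma prod_pochs a m c : \prod_(d <- pochs a m) (d + c) = poch (a + c) m.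
Proof.
rewrite /pochs big_map /poch -[X in iota _ X]subn0 -/(index_iota 0 m) big_mkord.
by apply: eq_bigr => i _; ring.
Qed.

Let prod_pochsB a m c : \prod_(d <- pochs a m) (d - c) = poch (a - c) m.
Proof. exact: prod_pochs. Qed.

Let poch_swap a i k : poch a i * poch (a + i%:R) k = poch a k * poch (a + k%:R) i.
Proof. by rewrite -!pochD addnC. Qed.

(** The ratio in [jacobi_moment] reduces to a product of [n - 1] linear factors,
    too few to survive an [n]-th difference. *)
Lemma jacobi_orthogonal a b n i : -1 < a -> -1 < b -> (i < n)%N ->
  \int[mu]_(x in I01) (sjacobi a b n x * w b (a + i%:R) x) = 0.
Proof.
move=> a1 b1 lin; have i0 := ler0n R i.
rewrite jacobi_moment//; last by lra.
set s := a + b + 2; have s0 : 0 < s by rewrite /s; lra.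
pose m := (n - i.+1)%N; have nE : n = (i.+1 + m)%N by rewrite subnKC.
rewrite (@fdiff_ext _ _ _ (fun k => (poch (a + 1) i * poch (s + i%:R) m)^-1 *
  \prod_(c <- pochs (a + 1) i ++ pochs (s + i%:R) m) (c + k%:R))); last first.
  move=> k; rewrite big_cat /= !prod_pochs.
  have e1 := poch_swap (a + 1) i k.
  have e2 := poch_swap (s + i%:R) m k.
  have -> : n%:R + a + b + 1 = s + i%:R + m%:R.
    by rewrite nE natrD -natr1 /s; ring.
  have -> : a + i%:R + 1 = a + 1 + i%:R by ring.
  have -> : a + i%:R + b + 2 = s + i%:R by rewrite /s; ring.
  have A0 : 0 < poch (a + 1) k by apply: poch_gt0; lra.
  have A1 : 0 < poch (a + 1) i by apply: poch_gt0; lra.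
  have A2 : 0 < poch (s + i%:R) k by apply: poch_gt0; lra.
  have A3 : 0 < poch (s + i%:R) m by apply: poch_gt0; lra.
  apply: (mulfI (x := poch (a + 1) i * poch (s + i%:R) m *
      poch (a + 1) k * poch (s + i%:R) k)); first by rewrite !mulf_neq0 ?gt_eqF.
  transitivity ((poch (a + 1) i * poch (a + 1 + i%:R) k) *
      (poch (s + i%:R) m * poch (s + i%:R + m%:R) k)).
    by field; rewrite !gt_eqF.
  by rewrite e1 e2; field; rewrite !gt_eqF.
rewrite fdiffZ fdiff_prod ?mulr0// size_cat !size_pochs nE.
by rewrite addSn.
Qed.

(** Compared with [jacobi_orthogonal] one factor of the denominator is not
    cancelled, and the moment is the contribution of that simple pole. *)
Lemma jacobi_moment_top a b n : -1 < a -> -1 < b ->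
  \int[mu]_(x in I01) (sjacobi a b n x * w b (a + n%:R) x) =
  beta_int b a * ((-1) ^+ n * poch (a + 1) n * poch (b + 1) n /
                  poch (a + b + 2) n.*2).
Proof.
move=> a1 b1; have n0 := ler0n R n.
(* For [n = 0] the pole [c = a + b + 1] below need not be positive. *)
case: n n0 => [|m] n0.
  by rewrite jacobi_moment ?addr0//= !poch0 fact0 expr0; field.
set n := m.+1 in n0 *.
rewrite jacobi_moment//; last by lra.
set s := a + b + 2; have s0 : 0 < s by rewrite /s; lra.
pose c := s + m%:R; have m0 := ler0n R m.
have c0 : 0 < c by rewrite /c; lra.
have nm : n%:R = m%:R + 1 :> R by rewrite natr1.
rewrite (@fdiff_ext _ _ _ (fun k => (c / poch (a + 1) n) *
  (\prod_(d <- pochs (a + 1) n) (d + k%:R) / (c + k%:R)))); last first.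
  move=> k; rewrite !prod_pochs.
  have e1 := poch_swap (a + 1) n k.
  have -> : n%:R + a + b + 1 = c by rewrite nm /c /s; ring.
  have -> : a + n%:R + 1 = a + 1 + n%:R by ring.
  have -> : a + n%:R + b + 2 = c + 1 by rewrite nm /c /s; ring.
  have e2 : poch c k * (c + k%:R) = c * poch (c + 1) k by rewrite -pochSr pochSl.
  have A0 : 0 < poch (a + 1) k by apply: poch_gt0; lra.
  have A1 : 0 < poch (a + 1) n by apply: poch_gt0; lra.
  have A2 : 0 < poch (c + 1) k by apply: poch_gt0; lra.
  have k0 := ler0n R k.
  have A3 : 0 < c + k%:R by lra.
  apply: (mulfI (x := poch (a + 1) n * poch (a + 1) k * poch (c + 1) k *
      (c + k%:R))); first by rewrite !mulf_neq0 ?gt_eqF.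
  transitivity ((poch (a + 1) n * poch (a + 1 + n%:R) k) *
      (poch c k * (c + k%:R))).
    by field; rewrite !gt_eqF.
  by rewrite e1 e2; field; rewrite !gt_eqF.
rewrite fdiffZ fdiff_prod_div ?size_pochs// prod_pochsB.
have -> : poch (a + 1 - c) n = (-1) ^+ n * poch (b + 1) n.
  rewrite /poch (reindex_inj rev_ord_inj) /= -{7}(card_ord n) -prodrN.
  apply: eq_bigr => i _; rewrite natrB ?ltn_ord// /c /s nm -natr1.
  by ring.
rewrite beta_int_shift// -/s -addnn pochD pochSl.
have -> : c + 1 = s + n%:R by rewrite nm /c; ring.
have A1 : 0 < poch (a + 1) n by apply: poch_gt0; lra.
have A2 : 0 < poch s n by apply: poch_gt0.
have A3 : 0 < poch (s + n%:R) n by apply: poch_gt0; lra.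
have F0 : 0 < n`!%:R :> R by rewrite ltr0n fact_gt0.
by field; rewrite !gt_eqF.
Qed.

(** With the weight exponent lowered by one the alternating sum has a single
    simple pole, so that the moment is a ratio of Gamma factors. *)
Lemma jacobi_moment_lower a b n : 0 < a -> -1 < b ->
  \int[mu]_(x in I01) (sjacobi a b n x * w b (a - 1) x) =
  beta_int b (a - 1) * (poch (b + 1) n / poch (a + b + 1) n).
Proof.
move=> a0 b1; rewrite jacobi_moment//; [|lra|lra].
set d := a + b + 1; have d0 : 0 < d by rewrite /d; lra.
rewrite (@fdiff_ext _ _ _ (fun k => (a / poch d n) *
  (\prod_(e <- pochs d n) (e + k%:R) / (a + k%:R)))); last first.
  move=> k; rewrite !prod_pochs.
  have e1 := poch_swap d n k.
  have -> : n%:R + a + b + 1 = d + n%:R by rewrite /d; ring.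
  have -> : a - 1 + 1 = a by ring.
  have -> : a - 1 + b + 2 = d by rewrite /d; ring.
  have e2 : poch a k * (a + k%:R) = a * poch (a + 1) k by rewrite -pochSr pochSl.
  have A0 : 0 < poch (a + 1) k by apply: poch_gt0; lra.
  have A1 : 0 < poch d k by apply: poch_gt0.
  have A2 : 0 < poch d n by apply: poch_gt0.
  have k0 := ler0n R k.
  have A3 : 0 < a + k%:R by lra.
  apply: (mulfI (x := poch (a + 1) k * poch d k * poch d n *
      (a + k%:R))); first by rewrite !mulf_neq0 ?gt_eqF.
  transitivity ((poch d n * poch (d + n%:R) k) * (poch a k * (a + k%:R))).
    by field; rewrite !gt_eqF.
  by rewrite e1 e2; field; rewrite !gt_eqF.
rewrite fdiffZ fdiff_prod_div ?size_pochs// prod_pochsB pochSl.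
have -> : d - a = b + 1 by rewrite /d; ring.
have A1 : 0 < poch (a + 1) n by apply: poch_gt0; lra.
have A2 : 0 < poch d n by apply: poch_gt0.
have F0 : 0 < n`!%:R :> R by rewrite ltr0n fact_gt0.
by field; rewrite !gt_eqF.
Qed.

End JacobiMoments.

(** * Semi-inner products and weighted square-integrable functions *)

(** [D] is the space of functions of finite norm.  Bilinearity has to be confined
    to it because the real-valued integral is 0 on functions that are not
    integrable. *)
Record semi_inner_product (R : realType) (T : Type) (D : (T -> R) -> Prop)
    (ip : (T -> R) -> (T -> R) -> R) : Prop := SemiInnerProduct {
  sip_dom0 : D (fun=> 0);
  sip_domD : forall a f g, D f -> D g -> D (fun x => a * f x + g x);
  sip_sym : forall f g, D f -> D g -> ip f g = ip g f;
  sip_lin : forall a f g h, D f -> D g -> D h ->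
    ip (fun x => a * f x + g x) h = a * ip f h + ip g h;
  sip_ge0 : forall f, D f -> 0 <= ip f f }.

Section SemiInnerProduct.
Context {R : realType} {T : Type}.
Variables (D : (T -> R) -> Prop) (ip : (T -> R) -> (T -> R) -> R).
Hypothesis hip : semi_inner_product D ip.
Implicit Types (f g h : T -> R) (a : R).

Lemma sip_domB f g : D f -> D g -> D (fun x => f x - g x).
Proof.
move=> Df Dg; have := sip_domD hip (-1) Dg Df.
by congr D; apply/funext => x; ring.
Qed.

Lemma sip_linr a f g h : D f -> D g -> D h ->
  ip h (fun x => a * f x + g x) = a * ip h f + ip h g.
Proof.
move=> Df Dg Dh; rewrite (sip_sym hip Dh (sip_domD hip a Df Dg)) (sip_lin hip)//.
by rewrite (sip_sym hip Df Dh) (sip_sym hip Dg Dh).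
Qed.

Lemma sip_subl f g h : D f -> D g -> D h ->
  ip (fun x => f x - g x) h = ip f h - ip g h.
Proof.
move=> Df Dg Dh; have := sip_lin hip (-1) Dg Df Dh.
rewrite (_ : (fun x => _) = (fun x => f x - g x)); last by apply/funext => x; ring.
by move=> ->; ring.
Qed.

Lemma sip0l h : D h -> ip (fun=> 0) h = 0.
Proof.
move=> Dh; have := sip_lin hip 1 (sip_dom0 hip) (sip_dom0 hip) Dh.
rewrite (_ : (fun x => _) = (fun=> 0)); last by apply/funext => x; ring.
lra.
Qed.

Lemma sip_sq a f g : D f -> D g ->
  ip (fun x => a * f x + g x) (fun x => a * f x + g x) =
  a ^+ 2 * ip f f + 2 * a * ip f g + ip g g.
Proof.
move=> Df Dg; have Dfg := sip_domD hip a Df Dg.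
by rewrite (sip_lin hip)// !sip_linr// (sip_sym hip Dg Df); ring.
Qed.

Lemma sip_cauchy_schwarz f g : D f -> D g -> ip f g ^+ 2 <= ip f f * ip g g.
Proof.
move=> Df Dg; have f0 := sip_ge0 hip Df; have g0 := sip_ge0 hip Dg.
have quad a : 0 <= a ^+ 2 * ip f f + 2 * a * ip f g + ip g g.
  by rewrite -sip_sq//; apply: (sip_ge0 hip); exact: (sip_domD hip).
move: f0; rewrite le_eqVlt => /predU1P[f0|f0].
  suff -> : ip f g = 0 by rewrite expr0n /= -f0 mul0r.
  have [//|n0] := eqVneq (ip f g) 0.
  have := quad (- (ip g g + 1) / (2 * ip f g)).
  rewrite -f0 mulr0 add0r.
  have -> : 2 * (- (ip g g + 1) / (2 * ip f g)) * ip f g = - (ip g g + 1).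
    by field.
  by rewrite opprD; lra.
have := quad (- ip f g / ip f f).
have -> : (- ip f g / ip f f) ^+ 2 * ip f f + 2 * (- ip f g / ip f f) * ip f g +
    ip g g = (ip f f * ip g g - ip f g ^+ 2) / ip f f.
  by field; rewrite gt_eqF.
by rewrite pmulr_lge0 ?invr_gt0// subr_ge0.
Qed.

(** Along a null vector the division is by 0, but then the numerator vanishes too
    by Cauchy-Schwarz. *)
Lemma sip_coefK f g : D f -> D g -> ip f g / ip g g * ip g g = ip f g.
Proof.
move=> Df Dg; have [g0|g0] := eqVneq (ip g g) 0; last by rewrite divfK.
rewrite g0 mulr0; have := sip_cauchy_schwarz Df Dg; rewrite g0 mulr0.
by have := sqr_ge0 (ip f g) => h1 h2; apply/esym/eqP; rewrite -sqrf_eq0 eq_le h1 h2.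
Qed.

Lemma sip_sqrD_le f g : D f -> D g ->
  ip (fun x => f x + g x) (fun x => f x + g x) <= 2 * ip f f + 2 * ip g g.
Proof.
move=> Df Dg; have := sip_sq 1 Df Dg; have := sip_sq (-1) Df Dg.
rewrite (_ : (fun x => 1 * f x + g x) = (fun x => f x + g x)); last first.
  by apply/funext => x; ring.
have := sip_ge0 hip (sip_domD hip (-1) Df Dg); move=> h1 h2 ->; lra.
Qed.

Lemma sip_best_approximation f g h : D f -> D g -> D h ->
  ip (fun x => f x - g x) (fun x => h x - g x) = 0 ->
  ip (fun x => f x - g x) (fun x => f x - g x) <=
  ip (fun x => f x - h x) (fun x => f x - h x).
Proof.
move=> Df Dg Dh e.
have Dfg := sip_domB Df Dg; have Dhg := sip_domB Dh Dg.
have := sip_sq (-1) Dhg Dfg; rewrite (sip_sym hip Dhg Dfg) e.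
rewrite (_ : (fun x => -1 * _ + _) = (fun x => f x - h x)); last first.
  by apply/funext => x; ring.
have := sip_ge0 hip Dhg; move=> h1 ->; lra.
Qed.

Section Sums.
Context {I : eqType}.
Variable (e : I -> T -> R).
Hypothesis De : forall i, D (e i).

Lemma sip_dom_sum (r : seq I) (c : I -> R) :
  D (fun x => \sum_(i <- r) c i * e i x).
Proof.
elim: r => [|i r IH].
  by have := sip_dom0 hip; congr D; apply/funext => x; rewrite big_nil.
have := sip_domD hip (c i) (De i) IH; congr D.
by apply/funext => x; rewrite big_cons.
Qed.

Lemma sip_sum (r : seq I) (c : I -> R) h : D h ->
  ip (fun x => \sum_(i <- r) c i * e i x) h = \sum_(i <- r) c i * ip (e i) h.
Proof.
move=> Dh; elim: r => [|i r IH].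
  rewrite big_nil; transitivity (ip (fun=> 0) h); last exact: sip0l.
  by congr ip; apply/funext => x; rewrite big_nil.
rewrite big_cons -IH -(sip_lin hip)//; last exact: sip_dom_sum.
by congr ip; apply/funext => x; rewrite big_cons.
Qed.

Lemma sip_fourier_residual (r : seq I) f i : uniq r -> D f ->
  (forall j, j \in r -> j != i -> ip (e j) (e i) = 0) -> i \in r ->
  ip (fun x => f x - \sum_(j <- r) ip f (e j) / ip (e j) (e j) * e j x) (e i) = 0.
Proof.
move=> ur Df orth ir.
rewrite sip_subl//; last exact: sip_dom_sum.
rewrite sip_sum// (bigD1_seq i)//= big_seq_cond big1 ?addr0.
  by rewrite sip_coefK ?subrr.
by move=> j /andP[jr ji]; rewrite orth ?mulr0.
Qed.

End Sums.
End SemiInnerProduct.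

Section WeightedL2.
Context {R : realType}.
Local Notation mu := (@lebesgue_measure R).
Local Notation I01 := (`[0%R, 1%R]%classic : set R).
Implicit Types (f g h : R -> R).
Variable v : R -> R.
Hypothesis v0 : forall x, 0 <= v x.
Hypothesis iv : mu.-integrable I01 (EFin \o v).

Let mv : measurable_fun I01 v.
Proof. by apply/measurable_EFinP; exact: measurable_int iv. Qed.

Lemma in_L2P g : in_L2 v g <-> measurable_fun I01 g /\
  mu.-integrable I01 (EFin \o (fun x => g x * g x * v x)).
Proof.
have e : (\int[mu]_(x in I01) (`|g x| ^+ 2 * v x)%:E =
    \int[mu]_(x in I01) `|(g x * g x * v x)%:E|)%E.
  apply: eq_integral => x _; rewrite real_normK ?num_real// expr2.
  by rewrite gee0_abs// lee_fin mulr_ge0// -expr2 sqr_ge0.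
rewrite /in_L2 e; split=> -[mg h]; split=> //.
  apply/integrableP; split=> //; apply/measurable_EFinP.
  by do 2 apply: measurable_funM => //.
by case/integrableP : h.
Qed.

Lemma integrable_L2_prod f g : in_L2 v f -> in_L2 v g ->
  mu.-integrable I01 (EFin \o (fun x => f x * g x * v x)).
Proof.
move=> /in_L2P[mf f2] /in_L2P[mg g2].
have ig := integrable_add f2 g2.
apply: (le_integrable _ _ _ ig) => //.
  by apply/measurable_EFinP; do 2 apply: measurable_funM => //.
move=> x _; rewrite /= lee_fin -mulrDl !normrM (ger0_norm (v0 x)).
apply: ler_wpM2r => //.
rewrite [leRHS]ger0_norm ?addr_ge0 -?expr2 ?sqr_ge0//.
rewrite -[f x ^+ 2]real_normK ?num_real// -[g x ^+ 2]real_normK ?num_real//.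
by have := sqr_ge0 (`|f x| - `|g x|); have := sqr_ge0 (`|f x| + `|g x|); nra.
Qed.

Lemma L2_semi_inner_product : semi_inner_product (in_L2 v) (L2ip v).
Proof.
have D0 : in_L2 v (fun=> 0).
  apply/in_L2P; split=> //.
  have := @integrable0 _ _ _ mu I01.
  by apply: eq_integrable => // x _; rewrite /= !mul0r.
split=> //.
- move=> a f g Df Dg; have [/in_L2P [mf f2] /in_L2P[mg g2]] := (Df, Dg).
  apply/in_L2P; split.
    by apply: measurable_funD => //; exact: measurable_funM.
  have fg := integrable_L2_prod Df Dg.
  have := integrable_add (integrable_add (integrableZ (a ^+ 2) f2)
    (integrableZ (2 * a) fg)) g2.
  by apply: eq_integrable => // x _ /=; congr (_%:E); ring.
- by move=> f g _ _; apply: eq_Rintegral => x _; rewrite (mulrC (f x)).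
- move=> a f g h Df Dg Dh.
  have fh := integrable_L2_prod Df Dh; have gh := integrable_L2_prod Dg Dh.
  rewrite /L2ip -RintegralZl// -RintegralD//; last exact: integrableZ.
  by apply: eq_Rintegral => x _; ring.
- move=> f _; apply: Rintegral_ge0 => x _.
  by rewrite mulr_ge0// -expr2 sqr_ge0.
Qed.

Lemma L2normE g : L2norm v g = Num.sqrt (L2ip v g g).
Proof.
congr Num.sqrt; apply: eq_Rintegral => x _.
by rewrite real_normK ?num_real// expr2.
Qed.

Lemma bounded_in_L2 g (M : R) : measurable_fun I01 g ->
  (forall x, I01 x -> `|g x| <= M) -> in_L2 v g.
Proof.
move=> mg gM; apply/in_L2P; split=> //.
apply: (le_integrable _ _ _ (integrableZ (M ^+ 2) iv)) => //.
  by apply/measurable_EFinP; do 2 apply: measurable_funM => //.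
move=> x /gM h; rewrite /= lee_fin -expr2.
rewrite [leLHS]normrM [leRHS]normrM !normrX (ger0_norm (v0 x)).
apply: (ler_wpM2r (v0 x)).
by rewrite ler_sqr ?nnegrE//; exact: le_trans h (ler_norm M).
Qed.

Lemma horner_bounded01 (p : {poly R}) (x : R) : I01 x ->
  `|p.[x]| <= \sum_(i < size p) `|p`_i|.
Proof.
rewrite /= in_itv /= => /andP[x0 x1].
rewrite horner_coef; apply: (le_trans (ler_norm_sum _ _ _)).
apply: ler_sum => i _; rewrite normrM ler_piMr// normrX exprn_ile1//.
by rewrite ger0_norm.
Qed.

Lemma poly_in_L2 (p : {poly R}) : in_L2 v (horner p).
Proof.
apply: bounded_in_L2; first exact: measurable_poly.
exact: horner_bounded01.
Qed.

End WeightedL2.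

(** * Density of polynomials *)

Section Bernstein.
Context {R : realType}.
Implicit Types (f g : nat -> R) (c x M : R) (n k : nat).

(** The mean of [f] at the number of successes in [n] trials of probability ['X],
    conditioning on one trial at each step.  The Bernstein polynomial of a function
    [h] is the case [f k = h (k / n)]. *)
Fixpoint bernstein n f : {poly R} :=
  if n is m.+1 then 'X * bernstein m (fun k => f k.+1) + (1 - 'X) * bernstein m f
  else (f 0%N)%:P.

Lemma bernsteinS n f x : (bernstein n.+1 f).[x] =
  x * (bernstein n (fun k => f k.+1)).[x] + (1 - x) * (bernstein n f).[x].
Proof. by rewrite /= hornerD !hornerM !hornerE. Qed.

Lemma bernstein_cst n c x : (bernstein n (fun=> c)).[x] = c.
Proof. by elim: n => [|n IH]; rewrite ?hornerC// bernsteinS IH; ring. Qed.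

Lemma bernsteinD n f g x : (bernstein n (fun k => f k + g k)).[x] =
  (bernstein n f).[x] + (bernstein n g).[x].
Proof.
elim: n f g => [|n IH] f g; first by rewrite /= !hornerC.
by rewrite !bernsteinS !IH; ring.
Qed.

Lemma bernsteinZ n c f x : (bernstein n (fun k => c * f k)).[x] =
  c * (bernstein n f).[x].
Proof.
elim: n f => [|n IH] f; first by rewrite /= !hornerC.
by rewrite !bernsteinS !IH; ring.
Qed.

Lemma bernstein_le n f g x : 0 <= x <= 1 -> (forall k, f k <= g k) ->
  (bernstein n f).[x] <= (bernstein n g).[x].
Proof.
move=> /andP[x0 x1]; elim: n f g => [|n IH] f g fg; first by rewrite /= !hornerC.
by rewrite !bernsteinS lerD// ler_wpM2l ?subr_ge0// IH.
Qed.

Lemma bernstein_norm_le n f M x : 0 <= x <= 1 -> (forall k, `|f k| <= M) ->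
  `|(bernstein n f).[x]| <= M.
Proof.
move=> x01 fM; rewrite ler_norml; apply/andP; split.
  rewrite -(bernstein_cst n (- M) x); apply: bernstein_le => // k.
  by have := fM k; rewrite ler_norml => /andP[].
rewrite -(bernstein_cst n M x); apply: bernstein_le => // k.
by have := fM k; rewrite ler_norml => /andP[].
Qed.

(** Squared bias plus variance of the binomial law.  The induction shifts the
    centre, hence an arbitrary [c]. *)
Lemma bernstein_variance n c x :
  (bernstein n (fun k => (k%:R - c) ^+ 2)).[x] =
  (n%:R * x - c) ^+ 2 + n%:R * x * (1 - x).
Proof.
elim: n c => [|n IH] c; first by rewrite /= hornerC; ring.
rewrite bernsteinS IH.
have -> : (bernstein n (fun k => (k.+1%:R - c) ^+ 2)).[x] =
    (bernstein n (fun k => (k%:R - (c - 1)) ^+ 2)).[x].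
  congr (_.[x]); congr bernstein; apply/funext => k.
  by rewrite -natr1; ring.
by rewrite IH -natr1; ring.
Qed.

(** Chebyshev's argument: the deviation of [h] is at most [e / 2] plus a multiple
    of the squared distance, and the mean of the latter is of order [1 / n].
    Pointwise convergence is enough here, since dominated convergence will turn it
    into convergence in the weighted norm. *)
Lemma bernstein_cvg (h : R -> R) M x : (forall y, `|h y| <= M) ->
  {for x, continuous h} -> 0 <= x <= 1 ->
  (bernstein n.+1 (fun k => h (k%:R / n.+1%:R))).[x] @[n --> \oo] --> h x.
Proof.
move=> hM ch x01; apply/cvgrPdist_le => e e0.
have e2 : 0 < e / 2 by rewrite divr_gt0.
have M0 : 0 <= M := le_trans (normr_ge0 _) (hM 0).
have /cvgrPdist_le /(_ _ e2) /nbhs_ballP [d d0 hd] := ch.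
pose K := 2 * M / d ^+ 2.
have K0 : 0 <= K by rewrite divr_ge0 ?sqr_ge0 ?mulr_ge0.
have bnd n k : `|h (k%:R / n.+1%:R) - h x| <=
    e / 2 + (K / n.+1%:R ^+ 2) * (k%:R - n.+1%:R * x) ^+ 2.
  have n0 : 0 < n.+1%:R :> R by rewrite ltr0n.
  set y := k%:R / n.+1%:R.
  have -> : (K / n.+1%:R ^+ 2) * (k%:R - n.+1%:R * x) ^+ 2 = K * (y - x) ^+ 2.
    by rewrite /y; field; rewrite gt_eqF.
  have [yx|yx] := ltP `|x - y| d.
    apply: (@le_trans _ _ (e / 2)); first by rewrite distrC; exact: hd.
    by rewrite lerDl mulr_ge0 ?sqr_ge0.
  apply: (@le_trans _ _ (2 * M)).
    by apply: le_trans (ler_normB _ _) _; have := hM y; have := hM x; lra.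
  apply: (@le_trans _ _ (K * d ^+ 2)).
    by rewrite /K divfK// gt_eqF// exprn_gt0.
  apply: ler_wpDl; first exact: ltW.
  apply: ler_wpM2l => //; rewrite -[leRHS]real_normK ?num_real// distrC.
  by rewrite ler_sqr ?nnegrE// ltW.
have B n : `|h x - (bernstein n.+1 (fun k => h (k%:R / n.+1%:R))).[x]| <=
    e / 2 + K / n.+1%:R.
  set f := fun k => h (k%:R / n.+1%:R).
  have n0 : 0 < n.+1%:R :> R by rewrite ltr0n.
  pose G k : R := e / 2 + (K / n.+1%:R ^+ 2) * (k%:R - n.+1%:R * x) ^+ 2.
  have GE : (bernstein n.+1 G).[x] <= e / 2 + K / n.+1%:R.
    rewrite /G bernsteinD bernstein_cst bernsteinZ bernstein_variance.
    rewrite lerD2l subrr expr0n add0r.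
    have -> : K / n.+1%:R ^+ 2 * (n.+1%:R * x * (1 - x)) =
        K / n.+1%:R * (x * (1 - x)) by field; rewrite gt_eqF.
    move: x01 => /andP[x0 x1].
    rewrite ler_piMr ?divr_ge0 ?(ltW n0)//; nra.
  apply: le_trans GE.
  have e1 : (bernstein n.+1 (fun k => f k + - h x)).[x] =
      (bernstein n.+1 f).[x] - h x by rewrite bernsteinD bernstein_cst.
  have e3 : (bernstein n.+1 (fun k => -1 * f k + h x)).[x] =
      h x - (bernstein n.+1 f).[x] by rewrite bernsteinD bernsteinZ bernstein_cst; ring.
  rewrite ler_norml; apply/andP; split.
    rewrite lerNl opprB -e1; apply: bernstein_le => // k.
    exact: le_trans (ler_norm _) (bnd n k).
  rewrite -e3; apply: bernstein_le => // k.
  rewrite mulN1r addrC; apply: le_trans (ler_norm _) _; rewrite distrC; exact: bnd.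
near=> n; apply: le_trans (B n) _.
have : K / (e / 2) <= n%:R by near: n; exact: nbhs_infty_ger.
rewrite ler_pdivrMr// => Kn.
rewrite [leRHS]splitr lerD2l ler_pdivrMr ?ltr0n// -[n.+1%:R]natr1.
by rewrite mulrDr mulr1; apply: le_trans Kn _; rewrite mulrC lerDl; exact: ltW.
Unshelve. all: by end_near. Qed.

End Bernstein.

Section PolynomialDensity.
Context {R : realType}.
Local Notation mu := (@lebesgue_measure R).
Local Notation I01 := (`[0%R, 1%R]%classic : set R).
Implicit Types (f g h : R -> R) (e M : R).
Variable v : R -> R.
Hypothesis v0 : forall x, 0 <= v x.
Hypothesis iv : mu.-integrable I01 (EFin \o v).

Let hip := L2_semi_inner_product v0 iv.

Lemma L2ip_dominated_cvg (u : nat -> R -> R) g f :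
  (forall n, measurable_fun I01 (u n)) ->
  mu.-integrable I01 (EFin \o g) ->
  (forall n x, I01 x -> (u n x - f x) ^+ 2 * v x <= g x) ->
  measurable_fun I01 f ->
  (forall x, I01 x -> u n x @[n --> \oo] --> f x) ->
  L2ip v (fun x => f x - u n x) (fun x => f x - u n x) @[n --> \oo] --> (0 : R).
Proof.
move=> mu_ ig ug mf uf.
have mv : measurable_fun I01 v by apply/measurable_EFinP; exact: measurable_int iv.
have -> : (0 : R) = \int[mu]_(x in I01) 0 by rewrite Rintegral_cst// mul0r.
apply: (Rintegral_dominated_cvg _ _ ig) => //.
- by move=> n; do 2 apply: measurable_funM => //; exact: measurable_funB.
- move=> n x Ix; apply: le_trans (ug n x Ix).
  rewrite normrM (ger0_norm (v0 x)) -expr2 ger0_norm ?sqr_ge0//.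
  by rewrite -sqrrN opprB.
- move=> x Ix.
  have c : f x - u n x @[n --> \oo] --> (0 : R).
    rewrite -[X in _ --> X](subrr (f x)); apply: cvgB; first exact: cvg_cst.
    exact: uf.
  have cv : (fun _ : nat => v x) n @[n --> \oo] --> v x by exact: cvg_cst.
  by have := cvgM (cvgM c c) cv; rewrite !mul0r; apply.
Qed.

Lemma truncation_dense g e : in_L2 v g -> 0 < e -> exists (f : R -> R) (M : R),
  [/\ measurable_fun I01 f, forall x, `|f x| <= M &
      L2ip v (fun x => g x - f x) (fun x => g x - f x) < e].
Proof.
move=> /(in_L2P v0 iv) [mg ig] e0.
pose u n x : R := Num.max (- n%:R) (Num.min (g x) n%:R).
have mu_ n : measurable_fun I01 (u n).
  by apply: measurable_maxr => //; exact: measurable_minr.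
have ub n x : `|u n x| <= n%:R.
  rewrite /u ler_norml le_max lexx /= ge_max ge_min lexx orbT andbT.
  by have := ler0n R n; lra.
have ug n x : (u n x - g x) ^+ 2 <= g x * g x.
  rewrite /u; have n0 := ler0n R n.
  have [gn|gn] := leP (g x) n%:R.
    have [gn'|gn'] := leP (- n%:R) (g x); first by rewrite subrr expr0n -expr2 sqr_ge0.
    by nra.
  by have [?|?] := leP (- n%:R) n%:R; nra.
have cu : L2ip v (fun x => g x - u n x) (fun x => g x - u n x) @[n --> \oo] --> (0 : R).
  apply: (L2ip_dominated_cvg mu_ ig) => //.
    by move=> n x _; rewrite ler_wpM2r.
  move=> x _; apply: cvg_near_cst; near=> n.
  have : `|g x| <= n%:R by near: n; exact: nbhs_infty_ger.
  rewrite ler_norml => /andP[h1 h2].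
  by rewrite /u min_l// max_r.
have /cvgrPdist_lt /(_ _ e0) [n _ /(_ n (leqnn n))] := cu.
rewrite sub0r normrN => h; exists (u n), n%:R; split=> //.
exact: le_lt_trans (ler_norm _) h.
Unshelve. all: by end_near. Qed.

(** By Lusin's theorem [f] agrees with a bounded continuous function off a small
    set, and the integral of [v] over a small set is small. *)
Lemma continuous_dense f M e : measurable_fun I01 f -> (forall x, `|f x| <= M) ->
  0 < e -> exists h : R -> R, [/\ continuous h, forall x, `|h x| <= M + 1 &
      L2ip v (fun x => f x - h x) (fun x => f x - h x) < e].
Proof.
move=> mf fM e0; have M0 : 0 <= M := le_trans (normr_ge0 _) (fM 0).
pose C := (2 * (M + 1)) ^+ 2.
have C0 : 0 < C by rewrite exprn_gt0//; lra.
have ivT : mu.-integrable [set: R] (EFin \o (v \_ I01)).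
  have := integrable_mkcond (EFin \o v) (measurable_itv `[0%R, 1%R]) (mu := mu).
  by move=> /iffLR/(_ iv); rewrite restrict_EFin.
have [d [d0 hd]] := integral_normr_continuous ivT (divr_gt0 e0 C0).
have I01fin : (mu I01 < +oo)%E by rewrite lebesgue_measure_itv /= lte_fin ltr01 -EFinB ltry.
have [K [cK KI muK cKf]] := measurable_almost_continuous (measurable_itv _) I01fin d0 mf.
have M1 : 0 < M + 1 by lra.
(* The extension theorem asks for a positive bound, hence [M + 1]. *)
have [h [hf ch hM]] := continuous_bounded_extension (@pseudometric_normal _ _)
  (compact_closed (@Rhausdorff R) cK) M1 cKf
  (fun x _ => le_trans (fM x) (ler_wpDr ler01 (lexx M))).
exists h; split=> //.
have mK : measurable K := compact_measurable cK.
have mA : measurable (I01 `\` K) by exact: measurableD.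
set A := I01 `\` K in mA muK.
have mv : measurable_fun I01 v by apply/measurable_EFinP; exact: measurable_int iv.
have mvA : measurable_fun I01 (v \_ A).
  apply/(measurable_restrict v mA (measurable_itv _)).
  by apply: (measurable_funS _ _ mv) => // x [].
have iA : mu.-integrable I01 (EFin \o (v \_ A)).
  apply: (le_integrable _ _ _ iv) => //; first exact/measurable_EFinP.
  move=> x _; rewrite /= lee_fin /patch; case: ifP => // _.
  by rewrite normr0.
have Df : in_L2 v f by apply: (bounded_in_L2 v0 iv mf) => x _; exact: fM.
have Dh : in_L2 v h.
  apply: (bounded_in_L2 v0 iv (M := M + 1)) => //.
  by apply: measurable_funTS; exact: continuous_measurable_fun.
have Dfh := sip_domB hip Df Dh.
apply: (@le_lt_trans _ _ (\int[mu]_(x in I01) (C * (v \_ A) x))).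
  apply: le_Rintegral => //.
  - exact: integrable_L2_prod.
  - exact: integrableZ.
  - move=> x Ix; rewrite /patch; case: ifPn => [_|xA].
      apply: ler_wpM2r => //; rewrite -expr2 -real_normK ?num_real//.
      rewrite ler_sqr ?nnegrE//; last by lra.
      apply: le_trans (ler_normB _ _) _.
      by have := fM x; have := hM x; lra.
    have xK : K x.
      by apply: contrapT => nK; move: xA; rewrite notin_setE; apply; split.
    by rewrite (hf x) ?inE// subrr !mul0r mulr0.
rewrite RintegralZl//.
have -> : \int[mu]_(x in I01) (v \_ A) x = \int[mu]_(x in A) `|(v \_ I01) x|.
  rewrite -Rintegral_mkcondr setIidr; last by move=> x [].
  apply: eq_Rintegral => x /set_mem [Ix _].
  by rewrite /patch mem_set// ger0_norm.
have := hd A mA muK.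
by rewrite ltr_pdivlMr// mulrC.
Qed.

Lemma polynomial_dense h M e : continuous h -> (forall x, `|h x| <= M) -> 0 < e ->
  exists p : {poly R}, L2ip v (fun x => h x - p.[x]) (fun x => h x - p.[x]) < e.
Proof.
move=> ch hM e0.
have M0 : 0 <= M := le_trans (normr_ge0 _) (hM 0).
pose p n := bernstein n.+1 (fun k => h (k%:R / n.+1%:R)).
have /cvgrPdist_lt /(_ _ e0) [n _ /(_ n (leqnn n))] :
    L2ip v (fun x => h x - (p n).[x]) (fun x => h x - (p n).[x]) @[n --> \oo] --> (0 : R).
  apply: (L2ip_dominated_cvg (u := fun n => horner (p n)) _ (integrableZ ((2 * M) ^+ 2) iv)).
  - by move=> n; exact: measurable_poly.
  - move=> n x /=; rewrite in_itv /= => x01; apply: ler_wpM2r => //.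
    rewrite -[leLHS]real_normK ?num_real// ler_sqr ?nnegrE ?mulr_ge0//.
    apply: le_trans (ler_normB _ _) _; rewrite mulr_natl mulr2n; apply: lerD => //.
    exact: bernstein_norm_le.
  - by apply: measurable_funTS; exact: continuous_measurable_fun.
  - by move=> x /=; rewrite in_itv /= => x01; apply: bernstein_cvg => //; exact: ch.
rewrite sub0r normrN => hn; exists (p n).
exact: le_lt_trans (ler_norm _) hn.
Qed.

Theorem polynomials_dense_L2 g e : in_L2 v g -> 0 < e ->
  exists p : {poly R}, L2ip v (fun x => g x - p.[x]) (fun x => g x - p.[x]) < e.
Proof.
(* Two uses of [sip_sqrD_le] weigh the three errors by 2, 4 and 4. *)
move=> Dg e0; have e6 : 0 < e / 16 by rewrite divr_gt0.
have [f [M [mf fM gf]]] := truncation_dense Dg e6.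
have [h [ch hM fh]] := continuous_dense mf fM e6.
have [p hp] := polynomial_dense ch hM e6.
exists p.
have Df : in_L2 v f by apply: (bounded_in_L2 v0 iv mf) => x _; exact: fM.
have Dh : in_L2 v h.
  apply: (bounded_in_L2 v0 iv (M := M + 1)) => //.
  by apply: measurable_funTS; exact: continuous_measurable_fun.
have Dp := poly_in_L2 v0 iv p.
have := sip_sqrD_le hip (sip_domB hip Dg Df) (sip_domB hip Df Dp).
have := sip_sqrD_le hip (sip_domB hip Df Dh) (sip_domB hip Dh Dp).
rewrite (_ : (fun x => f x - h x + _) = (fun x => f x - p.[x])); last first.
  by apply/funext => x; rewrite addrA subrK.
rewrite (_ : (fun x => g x - f x + _) = (fun x => g x - p.[x])); last first.
  by apply/funext => x; rewrite addrA subrK.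
lra.
Qed.

End PolynomialDensity.

(** * Jacobi series on an edge *)

(** Polynomials of bounded degree are generated by any family with one member in
    each degree; as an induction principle this needs no named coefficients. *)
Lemma poly_triangular_ind (R : realType) (p : nat -> {poly R}) n
    (Q : {poly R} -> Prop) :
  (forall k, (size (p k) <= k.+1)%N) -> (forall k, (p k)`_k != 0) ->
  Q 0 -> (forall k c q, (k <= n)%N -> Q q -> Q (c *: p k + q)) ->
  forall q : {poly R}, (size q <= n.+1)%N -> Q q.
Proof.
move=> sp p0 Q0 QS.
suff H m : (m <= n.+1)%N -> forall q : {poly R}, (size q <= m)%N -> Q q by exact: H.
elim: m => [_ q|m IH mn q sq]; first by rewrite leqn0 size_poly_eq0 => /eqP ->.
pose c := q`_m / (p m)`_m.
rewrite (_ : q = c *: p m + (q - c *: p m)); last by rewrite addrC subrK.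
apply: QS => //; apply: IH; first exact: ltnW.
apply/leq_sizeP => j; rewrite leq_eqVlt coefB coefZ => /predU1P[<-|mj].
  by rewrite /c divfK// subrr.
rewrite (nth_default 0 (leq_trans sq mj)) (nth_default 0 (leq_trans (sp m) mj)).
by rewrite mulr0 subrr.
Qed.

Section JacobiSeries.
Context {R : realType}.
Local Notation mu := (@lebesgue_measure R).
Local Notation I01 := (`[0%R, 1%R]%classic : set R).
Variables (b a : R).
Hypotheses (b1 : -1 < b) (a1 : -1 < a).
Implicit Types (g : R -> R) (p q : {poly R}) (n k : nat).

Local Notation v := (w b a).
Local Notation P := (sjacobi a b).
Local Notation Pp := (sjpoly a b).

Let hip : semi_inner_product (in_L2 v) (L2ip v).
Proof. by apply: L2_semi_inner_product; [exact: w_ge0|exact: integrable_w]. Qed.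

Lemma poly_in_L2_w q : in_L2 v (horner q).
Proof. by apply: poly_in_L2; [exact: w_ge0|exact: integrable_w]. Qed.

Lemma sjacobi_horner n : P n = horner (Pp n).
Proof. by apply/funext => x; rewrite horner_sjpoly. Qed.

Lemma sjacobi_in_L2 n : in_L2 v (P n).
Proof. by rewrite sjacobi_horner; exact: poly_in_L2_w. Qed.

Lemma size_sjpoly n : (size (Pp n) <= n.+1)%N.
Proof.
apply: (leq_trans (size_sum _ _ _)); apply/bigmax_leqP => k _.
by apply: (leq_trans (size_scale_leq _ _)); rewrite size_exp_XsubC ltn_ord.
Qed.

Lemma jcoef_diag n : jcoef a b n n = poch (n%:R + a + b + 1) n / n`!%:R.
Proof. by rewrite /jcoef subnn poch0 fact0 !mulr1. Qed.

Lemma jcoef_diag_gt0 n : 0 < jcoef a b n n.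
Proof.
have hb := b1; have ha := a1.
rewrite jcoef_diag divr_gt0 ?ltr0n ?fact_gt0//.
case: n => [|n]; first by rewrite poch0.
by apply: poch_gt0; have n0 := ler0n R n; rewrite -[n.+1%:R]natr1; lra.
Qed.

Lemma coef_sjpoly n : (Pp n)`_n = jcoef a b n n.
Proof.
rewrite /sjpoly coef_sum big_ord_recr /= big1 ?add0r => [|k _].
  rewrite coefZ; have /monicP := monic_exp n (monicXsubC (1 : R)).
  by rewrite lead_coefE size_exp_XsubC => ->; rewrite mulr1.
by rewrite coefZ nth_default ?mulr0// size_exp_XsubC ltn_ord.
Qed.

Lemma coef_sjpoly_neq0 n : (Pp n)`_n != 0.
Proof. by rewrite coef_sjpoly gt_eqF// jcoef_diag_gt0. Qed.

Let onem_poly k : (fun x : R => (1 - x) ^+ k) = horner ((1 - 'X) ^+ k).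
Proof. by apply/funext => x; rewrite horner_exp !hornerE. Qed.

Let L2ip_onem n k : L2ip v (fun x => (1 - x) ^+ k) (P n) =
  \int[mu]_(x in I01) (P n x * w b (a + k%:R) x).
Proof.
apply: eq_Rintegral => x /set_mem /=; rewrite in_itv /= => /andP[_ x1].
by rewrite w_shift//; ring.
Qed.

Let L2ip_expand n m : L2ip v (P m) (P n) =
  \sum_(k < m.+1) (-1) ^+ k * jcoef a b m k *
    \int[mu]_(x in I01) (P n x * w b (a + k%:R) x).
Proof.
have De (k : 'I_m.+1) : in_L2 v (fun x => (1 - x) ^+ k).
  by rewrite onem_poly; exact: poly_in_L2_w.
have := sip_sum hip De (index_enum _) (fun k : 'I_m.+1 => (-1) ^+ k * jcoef a b m k) (sjacobi_in_L2 n).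
rewrite (_ : (fun x => _) = P m); last by apply/funext => x; rewrite sjacobiE.
by move=> ->; apply: eq_bigr => k _; rewrite L2ip_onem.
Qed.

Lemma sjacobi_orthogonal m n : m != n -> L2ip v (P m) (P n) = 0.
Proof.
wlog mn : m n / (m < n)%N => [H|_].
  rewrite neq_ltn => /orP[mn|nm]; first by rewrite H// ltn_eqF.
  by rewrite (sip_sym hip (sjacobi_in_L2 m) (sjacobi_in_L2 n)) H// ltn_eqF.
rewrite L2ip_expand big1// => k _; rewrite jacobi_orthogonal ?mulr0//.
exact: leq_ltn_trans (leq_ord k) mn.
Qed.

(** The squared norm of the [n]-th Jacobi polynomial. *)
Definition jnorm2 n : R := beta_int b a *
  (poch (a + 1) n * poch (b + 1) n * poch (n%:R + a + b + 1) n /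
   (n`!%:R * poch (a + b + 2) n.*2)).

Lemma sjacobi_norm n : L2ip v (P n) (P n) = jnorm2 n.
Proof.
have hb := b1; have ha := a1.
rewrite L2ip_expand big_ord_recr /= big1 ?add0r; last first.
  by move=> k _; rewrite jacobi_orthogonal ?mulr0.
rewrite jacobi_moment_top// jcoef_diag.
have S0 : 0 < poch (a + b + 2) n.*2 by apply: poch_gt0; lra.
have F0 : 0 < n`!%:R :> R by rewrite ltr0n fact_gt0.
have e : (-1) ^+ n * (-1) ^+ n = 1 :> R by rewrite -expr2 sqrr_sign.
transitivity ((-1) ^+ n * (-1) ^+ n * jnorm2 n); last by rewrite e mul1r.
by rewrite /jnorm2; field; rewrite !gt_eqF.
Qed.

Lemma jnorm2_gt0 n : 0 < jnorm2 n.
Proof.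
have hb := b1; have ha := a1.
rewrite /jnorm2 mulr_gt0 ?beta_int_gt0// divr_gt0 ?mulr_gt0 ?ltr0n ?fact_gt0//;
  try by apply: poch_gt0; lra.
by have := jcoef_diag_gt0 n; rewrite jcoef_diag pmulr_lgt0// invr_gt0 ltr0n fact_gt0.
Qed.

Let jnorm2S m : jnorm2 m.+1 = beta_int b a *
  (poch (a + 1) m.+1 * poch (b + 1) m.+1 /
   (m.+1`!%:R * (poch (a + b + 2) m * (a + b + 2 + m.*2.+1%:R)))).
Proof.
have hb := b1; have ha := a1.
rewrite /jnorm2 -[m.+1%:R]natr1; set s := a + b + 2.
have -> : m%:R + 1 + a + b + 1 = s + m%:R by rewrite /s; ring.
have m0 := ler0n R m.
have s0 : 0 < s by rewrite /s; lra.
have -> : m.+1.*2 = (m + m.+2)%N by rewrite -addnn addSnnS.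
rewrite pochD (pochSr _ m.+1).
have -> : s + m%:R + m.+1%:R = s + m.*2.+1%:R.
  by rewrite -addnn -addnS natrD addrA.
have A1 : 0 < poch s m by apply: poch_gt0.
have A2 : 0 < poch (s + m%:R) m.+1 by apply: poch_gt0; lra.
have A3 : 0 < s + m.*2.+1%:R by rewrite ltr_wpDr.
have F0 : 0 < m.+1`!%:R :> R by rewrite ltr0n fact_gt0.
move: (m.*2.+1%:R : R) A3 => y A3.
by field; rewrite !gt_eqF.
Qed.

Lemma sjacobi1_gt0 n : 0 < P n 1.
Proof.
have hb := b1; have ha := a1.
rewrite sjacobi1 gbinom_poch divr_gt0 ?ltr0n ?fact_gt0//.
by apply: poch_gt0; lra.
Qed.

Lemma sjacobi1S n : P n.+1 1 / P n 1 = (a + 1 + n%:R) / n.+1%:R.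
Proof.
have hb := b1; have ha := a1.
have A : 0 < poch (a + 1) n by apply: poch_gt0; lra.
have F0 : 0 < n`!%:R :> R by rewrite ltr0n fact_gt0.
rewrite !sjacobi1 !gbinom_poch pochSr factS natrM.
by field; rewrite !gt_eqF.
Qed.

(** The quantities [P n 1 ^+ 2 / jnorm2 n] grow like a power of [n], so the
    ratio of consecutive ones is bounded. *)
Lemma jnorm2_ratio : exists2 C : R, 0 < C &
  forall n, (P n.+1 1 / P n 1) ^+ 2 * jnorm2 n <= C * jnorm2 n.+1.
Proof.
have hb := b1; have ha := a1.
have N0 := jnorm2_gt0 0; have N1 := jnorm2_gt0 1.
pose C0 := (P 1 1 / P 0 1) ^+ 2 * jnorm2 0 / jnorm2 1.
have C00 : 0 <= C0 by apply: divr_ge0; [apply: mulr_ge0; [exact: sqr_ge0|exact: ltW]|exact: ltW].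
(* The ratio of the two sides for [n = m + 1] is a product of three fractions,
   bounded by [1 + `|a|], [1 + `|a|] and 3. *)
pose C1 := 3 * (1 + `|a|) ^+ 2.
have C10 : 0 < C1 by rewrite mulr_gt0// exprn_gt0// ltr_wpDr.
exists (C0 + C1); first by rewrite ltr_wpDl.
case=> [|m].
  by rewrite mulrDl /C0 divfK ?gt_eqF// lerDl mulr_ge0 ?ltW.
apply: (@le_trans _ _ (C1 * jnorm2 m.+2)); last first.
  by rewrite ler_pM2r ?jnorm2_gt0// lerDr.
rewrite sjacobi1S !jnorm2S !(pochSr _ m.+1) (pochSr (a + b + 2)) (factS m.+1) natrM.
have m0 := ler0n R m.
set s := a + b + 2; have s0 : 0 < s by rewrite /s; lra.
have A1 : 0 < poch s m by apply: poch_gt0.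
have A2 : 0 < poch (a + 1) m.+1 by apply: poch_gt0; lra.
have A3 : 0 < poch (b + 1) m.+1 by apply: poch_gt0; lra.
have F0 : 0 < m.+1`!%:R :> R by rewrite ltr0n fact_gt0.
have B0 := beta_int_gt0 b1 a1.
have e1 : m.*2.+1%:R = 2 * m%:R + 1 :> R by rewrite -natr1 -addnn natrD; ring.
have e2 : m.+1.*2.+1%:R = 2 * m%:R + 3 :> R.
  by rewrite -natr1 -addnn natrD -natr1; ring.
have e3 : m.+2%:R = m%:R + 2 :> R by rewrite -!natr1; ring.
have e4 : m.+1%:R = m%:R + 1 :> R by rewrite -!natr1.
rewrite e1 e2 e3 e4; set t := m%:R in m0 *.
pose X := beta_int b a * poch (a + 1) m.+1 * poch (b + 1) m.+1 /
  (m.+1`!%:R * poch s m).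
have X0 : 0 < X by do ?[apply: divr_gt0 | apply: mulr_gt0].
have Y1 : 0 < a + 2 + t by lra.
have Y2 : 0 < b + 2 + t by lra.
have Y3 : 0 < s + t by lra.
have Y4 : 0 < s + (2 * t + 1) by lra.
have Y5 : 0 < s + (2 * t + 3) by lra.
have Y6 : 0 < t + 2 by lra.
pose Z := X * (a + 2 + t) / ((t + 2) ^+ 2 * (s + t) * (s + (2 * t + 1)) * (s + (2 * t + 3))).
have Z0 : 0 < Z by do ?[apply: divr_gt0 | apply: mulr_gt0 | apply: exprn_gt0].
rewrite [leLHS](_ : _ = Z * ((a + 2 + t) * (s + t) * (s + (2 * t + 3)))); last first.
  by rewrite /Z /X; field; rewrite !gt_eqF.
rewrite [leRHS](_ : _ = Z * (C1 * ((t + 2) * (b + 2 + t) * (s + (2 * t + 1))))); last first.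
  by rewrite /Z /X; field; rewrite !gt_eqF.
rewrite ler_pM2l//.
have na := normr_ge0 a; have la := ler_norm a.
apply: (@le_trans _ _ (((1 + `|a|) * (t + 2)) * ((1 + `|a|) * (b + 2 + t)) *
    (3 * (s + (2 * t + 1))))).
  apply: ler_pM; rewrite ?mulr_ge0 ?(ltW Y1) ?(ltW Y3) ?(ltW Y5)//.
    by apply: ler_pM; rewrite ?(ltW Y1) ?(ltW Y3)// /s; nra.
  by rewrite /s; lra.
by rewrite le_eqVlt; apply/orP; left; apply/eqP; rewrite /C1; ring.
Qed.

Lemma L2ip_lowdeg q n : (size q <= n)%N -> L2ip v (horner q) (P n) = 0.
Proof.
case: n => [|n].
  rewrite leqn0 size_poly_eq0 => /eqP ->.
  rewrite -[RHS](sip0l hip (sjacobi_in_L2 0)); congr (L2ip _ _ _).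
  by apply/funext => x; rewrite horner0.
move: q; apply: (poly_triangular_ind (p := Pp)
    (Q := fun q => L2ip v (horner q) (P n.+1) = 0));
  [exact: size_sjpoly|exact: coef_sjpoly_neq0| |].
  rewrite -[RHS](sip0l hip (sjacobi_in_L2 n.+1)); congr (L2ip _ _ _).
  by apply/funext => x; rewrite horner0.
move=> k c q kn IH.
rewrite (_ : horner _ = (fun x => c * P k x + q.[x])); last first.
  by apply/funext => x; rewrite !hornerE horner_sjpoly.
rewrite (sip_lin hip) ?IH ?sjacobi_orthogonal ?mulr0 ?addr0//.
- by rewrite ltn_eqF.
- exact: sjacobi_in_L2.
- exact: poly_in_L2_w.
- exact: sjacobi_in_L2.
Qed.

Definition psum_poly n g : {poly R} :=
  \sum_(0 <= k < n.+1) (L2ip v g (P k) / L2ip v (P k) (P k)) *: Pp k.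

Lemma horner_psum_poly n g : horner (psum_poly n g) = psum1 b a n g.
Proof.
apply/funext => x; rewrite horner_sum; apply: eq_bigr => k _.
by rewrite hornerZ horner_sjpoly.
Qed.

Lemma size_psum_poly n g : (size (psum_poly n g) <= n.+1)%N.
Proof.
rewrite /psum_poly big_mkord; apply: (leq_trans (size_sum _ _ _)).
apply/bigmax_leqP => k _; apply: (leq_trans (size_scale_leq _ _)).
exact: leq_trans (size_sjpoly k) (ltn_ord k).
Qed.

Lemma psum1_in_L2 n g : in_L2 v (psum1 b a n g).
Proof. by rewrite -horner_psum_poly; exact: poly_in_L2_w. Qed.

Lemma psum1_best_approximation n g q : in_L2 v g -> (size q <= n.+1)%N ->
  L2ip v (fun x => g x - psum1 b a n g x) (fun x => g x - psum1 b a n g x) <=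
  L2ip v (fun x => g x - q.[x]) (fun x => g x - q.[x]).
Proof.
move=> Dg sq; have Ds := psum1_in_L2 n g.
have Dr := sip_domB hip Dg Ds.
apply: (sip_best_approximation hip) => //; first exact: poly_in_L2_w.
rewrite (_ : (fun x => q.[x] - _) = horner (q - psum_poly n g)); last first.
  by apply/funext => x; rewrite hornerD hornerN horner_psum_poly.
have : (size (q - psum_poly n g)%R <= n.+1)%N.
  by rewrite (leq_trans (size_polyD _ _))// size_polyN geq_max sq size_psum_poly.
move: (q - _) => {sq}q.
rewrite (sip_sym hip Dr (poly_in_L2_w q)).
set r := (fun x => g x - _) in Dr *.
move: q; apply: (poly_triangular_ind (p := Pp)
    (Q := fun q => L2ip v (horner q) r = 0)); [exact: size_sjpoly|exact: coef_sjpoly_neq0| |].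
  rewrite -[RHS](sip0l hip Dr); congr (L2ip _ _ _).
  by apply/funext => x; rewrite horner0.
move=> k c q kn IH.
rewrite (_ : horner _ = (fun x => c * P k x + q.[x])); last first.
  by apply/funext => x; rewrite !hornerE horner_sjpoly.
rewrite (sip_lin hip)//; [|exact: sjacobi_in_L2|exact: poly_in_L2_w].
rewrite IH addr0 (sip_sym hip (sjacobi_in_L2 k) Dr).
have := @sip_fourier_residual _ _ _ _ hip _ P sjacobi_in_L2 (index_iota 0 n.+1) g k.
rewrite /r /psum1 => ->; rewrite ?mulr0 ?iota_uniq//.
  by move=> j _ jk; rewrite sjacobi_orthogonal.
by rewrite mem_index_iota.
Qed.

Lemma jacobi_series_cvg g : in_L2 v g ->
  L2norm v (fun x => g x - psum1 b a n g x) @[n --> \oo] --> (0 : R).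
Proof.
move=> Dg; apply/cvgrPdist_lt => e e0.
have [q gq] := polynomials_dense_L2 (w_ge0 b a) (integrable_w b1 a1) Dg
  (exprn_gt0 2 e0).
near=> n; rewrite sub0r normrN (L2normE (w b a)) ger0_norm ?sqrtr_ge0//.
rewrite -[ltRHS]ger0_norm ?(ltW e0)// -sqrtr_sqr ltr_sqrt ?exprn_gt0//.
apply: le_lt_trans gq; apply: psum1_best_approximation => //.
by apply: leqW; near: n; exists (size q).
Unshelve. all: by end_near. Qed.

End JacobiSeries.

(** * Approximation with a prescribed corner value *)

Section EdgeApproximation.
Context {R : realType}.
Local Notation mu := (@lebesgue_measure R).
Local Notation I01 := (`[0%R, 1%R]%classic : set R).
Implicit Types (b a : R) (F G g : R -> R) (p q h : {poly R}) (n k : nat).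

Lemma L2norm_sq (v g : R -> R) : (forall x, 0 <= v x) ->
  L2norm v g ^+ 2 = L2ip v g g.
Proof.
move=> v0; rewrite L2normE sqr_sqrtr//; apply: Rintegral_ge0 => x _.
by rewrite mulr_ge0// -expr2 sqr_ge0.
Qed.

Definition quot F x := (F x - F 1) / (1 - x).

Lemma quotK F x : (1 - x) * quot F x = F x - F 1.
Proof.
rewrite /quot; have [->|x1] := eqVneq x 1; first by rewrite !subrr mul0r.
by rewrite mulrCA divff ?mulr1// subr_eq0 eq_sym.
Qed.

Lemma w_shift2 b a x : -1 < a -> x <= 1 -> w b (a + 2) x = w b a x * (1 - x) ^+ 2.
Proof. by move=> a1 x1; rewrite -(w_shift b 2 a1 x1). Qed.

Lemma in_L2_addcst b a F c : -1 < b -> -1 < a -> in_L2 (w b a) F ->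
  in_L2 (w b a) (fun x => F x - c).
Proof.
move=> b1 a1 DF.
have hip := L2_semi_inner_product (w_ge0 b a) (integrable_w b1 a1).
have := sip_domB hip DF (poly_in_L2_w b1 a1 c%:P).
by congr in_L2; apply/funext => x; rewrite hornerC.
Qed.

(** The factor [(1 - x) ^+ 2] of the new weight cancels the denominator, so the
    norm is that of [F - F 1]; at [x = 1] both integrands vanish. *)
Lemma quot_in_L2 b a F : -1 < b -> -1 < a -> in_L2 (w b a) F ->
  in_L2 (w b (a + 2)) (quot F).
Proof.
move=> b1 a1 DF; have := in_L2_addcst (F 1) b1 a1 DF.
have a2 : -1 < a + 2 by lra.
move=> /(in_L2P (w_ge0 b a) (integrable_w b1 a1)) [mF iF].
apply/(in_L2P (w_ge0 b _) (integrable_w b1 a2)); split.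
  apply: (eq_measurable_fun (fun x => (F x - F 1) * (1 - x) `^ (-1))).
    move=> x /set_mem /=; rewrite in_itv /= => /andP[_ x1].
    by rewrite /quot powR_inv1// subr_ge0.
  apply: measurable_funM => //; apply: measurable_funTS.
  have m1 : measurable_fun [set: R] (fun x : R => 1 - x) by exact: measurable_funB.
  exact: (measurableT_comp (measurable_powR (-1)) m1).
apply: eq_integrable iF => // x /set_mem /=; rewrite in_itv /= => /andP[_ x1].
by congr EFin; rewrite w_shift2// -quotK; ring.
Qed.

(** If [s] approximates the quotient then [F 1 + (1 - x) s] approximates [F]
    but has one degree too many.  Its top Jacobi component is small because
    the partial sum of [F] has none, and it can be traded for a multiple of the
    previous Jacobi polynomial with the same value at the corner. *)
Lemma edge_approximation b a : -1 < b -> -1 < a ->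
  exists2 C : R, 0 < C & forall F, in_L2 (w b a) F -> forall n,
  exists h, [/\ (size h <= n.+1)%N, h.[1] = F 1 &
    L2ip (w b a) (fun x => F x - h.[x]) (fun x => F x - h.[x]) <=
    C * (L2norm (w b a) (fun x => F x - psum1 b a n F x) ^+ 2 +
         L2norm (w b (a + 2))
           (fun x => quot F x - psum1 b (a + 2) n (quot F) x) ^+ 2)].
Proof.
move=> b1 a1; have [C C0 hC] := jnorm2_ratio b1 a1.
have a2 : -1 < a + 2 by lra.
exists (2 + 4 * (1 + C)); first by lra.
move=> F DF n.
have eE (c : R) (g : R -> R) : L2norm (w b c) g ^+ 2 = L2ip (w b c) g g.
  exact/L2norm_sq/w_ge0.
rewrite !eE.
set eF := L2ip (w b a) _ _; set eG := L2ip (w b (a + 2)) _ _.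
have hip := L2_semi_inner_product (w_ge0 b a) (integrable_w b1 a1).
have Dp q := poly_in_L2_w b1 a1 q.
set s := psum_poly b (a + 2) n (quot F).
pose H1 : {poly R} := (F 1)%:P + (1 - 'X) * s.
have sH1 : (size H1 <= n.+2)%N.
  rewrite (leq_trans (size_polyD _ _))// geq_max (leq_trans (size_polyC_leq1 _))//=.
  rewrite (leq_trans (size_polyMleq _ _))// -(size_polyN (1 - 'X)) opprB size_XsubC.
  by rewrite addSn /= add1n ltnS; exact: size_psum_poly.
have H11 : H1.[1] = F 1 by rewrite !hornerE subrr mul0r addr0.
have FH1 : L2ip (w b a) (fun x => F x - H1.[x]) (fun x => F x - H1.[x]) = eG.
  apply: eq_Rintegral => x /set_mem /=; rewrite in_itv /= => /andP[_ x1].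
  rewrite w_shift2// -horner_psum_poly -/s.
  have -> : F x - H1.[x] = (1 - x) * (quot F x - s.[x]).
    by rewrite mulrBr quotK !hornerE; ring.
  by ring.
pose l := (sjpoly a b n.+1)`_n.+1.
have l0 : l != 0 := coef_sjpoly_neq0 b1 a1 n.+1.
pose c := H1`_n.+1 / l.
pose N := jnorm2 b a.
pose rho := sjacobi a b n.+1 1 / sjacobi a b n 1.
pose T : {poly R} := sjpoly a b n.+1 - rho *: sjpoly a b n.
pose h : {poly R} := H1 - c *: T.
have sn : (size (sjpoly a b n) <= n.+1)%N by exact: size_sjpoly.
have P1 := sjacobi1_gt0 b1 a1 n.
have T1 : T.[1] = 0.
  by rewrite hornerD hornerN hornerZ !horner_sjpoly /rho divfK ?subrr// gt_eqF.
exists h; split.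
- apply/leq_sizeP => j; rewrite leq_eqVlt => /predU1P[<-|nj].
    by rewrite coefB coefZ coefB coefZ (nth_default 0 sn) mulr0 subr0 /c divfK ?subrr.
  rewrite coefB coefZ coefB coefZ (nth_default 0 (leq_trans sH1 nj)).
  rewrite (nth_default 0 (leq_trans (size_sjpoly _ _ _) nj)).
  by rewrite (nth_default 0 (leq_trans sn (ltnW nj))) !mulr0 !subr0 mulr0 subrr.
- by rewrite hornerD hornerN hornerZ T1 mulr0 subr0.
have Dpsum := psum1_in_L2 b1 a1 n F.
have DP k := sjacobi_in_L2 b1 a1 k.
pose Q x := H1.[x] - psum1 b a n F x.
have DQ : in_L2 (w b a) Q := sip_domB hip (Dp H1) Dpsum.
have QP : L2ip (w b a) Q (sjacobi a b n.+1) = c * N n.+1.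
  pose q0 : {poly R} := H1 - c *: sjpoly a b n.+1.
  have -> : Q = (fun x => c * sjacobi a b n.+1 x + (q0 - psum_poly b a n F).[x]).
    apply/funext => x; rewrite /Q -horner_psum_poly !hornerD !hornerN hornerZ horner_sjpoly.
    by ring.
  rewrite (sip_lin hip _ (DP _) (Dp _) (DP _)).
  rewrite (sjacobi_norm b1 a1) L2ip_lowdeg ?addr0//.
  rewrite (leq_trans (size_polyD _ _))// size_polyN geq_max size_psum_poly ?andbT.
  apply/leq_sizeP => j; rewrite leq_eqVlt coefB coefZ => /predU1P[<-|nj].
    by rewrite /c divfK ?subrr.
  rewrite (nth_default 0 (leq_trans sH1 nj)).
  by rewrite (nth_default 0 (leq_trans (size_sjpoly _ _ _) nj)) mulr0 subrr.
have eQ : L2ip (w b a) Q Q <= 2 * eG + 2 * eF.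
  have DFH := sip_domB hip (Dp H1) DF; have DFs := sip_domB hip DF Dpsum.
  have := sip_sqrD_le hip DFH DFs.
  rewrite (_ : (fun x => H1.[x] - F x + _) = Q); last first.
    by apply/funext => x; rewrite addrA subrK.
  rewrite -FH1 /eF => /le_trans; apply; rewrite lerD2r ler_pM2l// le_eqVlt.
  apply/orP; left; apply/eqP; apply: eq_Rintegral => x _; ring.
have Npos := jnorm2_gt0 b1 a1 n.+1.
have cN : c ^+ 2 * N n.+1 <= 2 * eG + 2 * eF.
  have := sip_cauchy_schwarz hip DQ (DP n.+1).
  rewrite QP (sjacobi_norm b1 a1) -/N => cs.
  apply: le_trans eQ; rewrite -(ler_pM2r Npos); apply: le_trans cs.
  by rewrite le_eqVlt; apply/orP; left; apply/eqP; rewrite -/N; ring.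
have TT : L2ip (w b a) (horner T) (horner T) = N n.+1 + rho ^+ 2 * N n.
  have -> : horner T = (fun x => - rho * sjacobi a b n x + sjacobi a b n.+1 x).
    apply/funext => x; rewrite !hornerE !horner_sjpoly; ring.
  rewrite (sip_sq hip)// !(sjacobi_norm b1 a1) sjacobi_orthogonal//.
    by rewrite -/N; ring.
  by rewrite neq_ltn ltnSn.
have := sip_sqrD_le hip (sip_domB hip DF (Dp H1)) (Dp (c *: T)).
rewrite FH1 (_ : (fun x => F x - _ + _) = (fun x => F x - h.[x])); last first.
  by apply/funext => x; rewrite /h !hornerE; ring.
have -> : L2ip (w b a) (horner (c *: T)) (horner (c *: T)) =
    c ^+ 2 * L2ip (w b a) (horner T) (horner T).
  have D0 := sip_dom0 hip.
  have := sip_sq hip c (Dp T) D0.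
  rewrite (_ : (fun x => c * T.[x] + 0) = horner (c *: T)); last first.
    by apply/funext => x; rewrite addr0 hornerZ.
  by move=> ->; rewrite (sip_sym hip (Dp T) D0) !(sip0l hip)//; ring.
move=> /le_trans; apply; rewrite TT.
have eG0 : 0 <= eG by rewrite -FH1; apply: (sip_ge0 hip); exact: (sip_domB hip).
have eF0 : 0 <= eF by apply: (sip_ge0 hip); exact: (sip_domB hip).
have hr : c ^+ 2 * (N n.+1 + rho ^+ 2 * N n) <= (1 + C) * (c ^+ 2 * N n.+1).
  have := hC n; rewrite -/rho -/N => h1.
  have := ler_wpM2l (sqr_ge0 c) h1; lra.
have : (1 + C) * (c ^+ 2 * N n.+1) <= (1 + C) * (2 * eG + 2 * eF).
  by rewrite ler_pM2l//; lra.
lra.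
Qed.

End EdgeApproximation.

(** * Orthogonal functions on the wedge *)

Section CornerPolynomials.
Context {R : realType}.
Local Notation mu := (@lebesgue_measure R).
Local Notation I01 := (`[0%R, 1%R]%classic : set R).
Variables (b a : R).
Hypotheses (b1 : -1 < b) (a1 : -1 < a).
Implicit Types (p : {poly R}) (m n : nat).

Let a2 : -1 < a + 2. Proof. by have ha := a1; lra. Qed.

Let hip := L2_semi_inner_product (w_ge0 b a) (integrable_w b1 a1).

Definition qcoef n : R := poch (a + b + 2) n / poch (b + 1) n.-1.

(** The restriction of [QO n] to an edge, apart from the factor [- sigma^-1] on
    the second one. *)
Definition qpoly n : {poly R} :=
  qcoef n *: ((1 - 'X) * sjpoly (a + 2) b n.-1).

Lemma horner_qpoly n x :
  (qpoly n).[x] = qcoef n * (1 - x) * sjacobi (a + 2) b n.-1 x.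
Proof. by rewrite hornerZ hornerM horner_sjpoly !hornerE. Qed.

Lemma qcoef_gt0 n : 0 < qcoef n.
Proof. by have ha := a1; have hb := b1; apply: divr_gt0; apply: poch_gt0; lra. Qed.

Lemma size_qpoly n : (0 < n)%N -> (size (qpoly n) <= n.+1)%N.
Proof.
case: n => // n _; rewrite (leq_trans (size_scale_leq _ _))//.
rewrite (leq_trans (size_polyMleq _ _))// -(size_polyN (1 - 'X)) opprB size_XsubC.
by rewrite addSn /= add1n ltnS; exact: size_sjpoly.
Qed.

Lemma coef_qpoly_lt0 n : (0 < n)%N -> (qpoly n)`_n < 0.
Proof.
case: n => // n _; rewrite coefZ pmulr_rlt0 ?qcoef_gt0//.
rewrite mulrBl mul1r coefB coefXM /= nth_default ?size_sjpoly// sub0r.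
by rewrite coef_sjpoly oppr_lt0 jcoef_diag_gt0.
Qed.

Let L2ip_onem2 p n : L2ip (w b a) (fun x => (1 - x) * p.[x])
    (fun x => (1 - x) * sjacobi (a + 2) b n x) =
  L2ip (w b (a + 2)) (horner p) (sjacobi (a + 2) b n).
Proof.
apply: eq_Rintegral => x /set_mem /=; rewrite in_itv /= => /andP[_ x1].
by rewrite w_shift2//; ring.
Qed.


Let Lq n : in_L2 (w b a) (fun x => (1 - x) * sjacobi (a + 2) b n x).
Proof.
have := poly_in_L2_w b1 a1 ((1 - 'X) * sjpoly (a + 2) b n).
by congr in_L2; apply/funext => x; rewrite hornerM horner_sjpoly !hornerE.
Qed.

Let qpolyE n : horner (qpoly n) =
  (fun x => qcoef n * ((1 - x) * sjacobi (a + 2) b n.-1 x) + 0).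
Proof. by apply/funext => x; rewrite horner_qpoly addr0 mulrA. Qed.

Let L2ip_qpolyl g n : in_L2 (w b a) g -> L2ip (w b a) g (horner (qpoly n)) =
  qcoef n * L2ip (w b a) g (fun x => (1 - x) * sjacobi (a + 2) b n.-1 x).
Proof.
move=> Dg; have D0 := sip_dom0 hip.
by rewrite qpolyE (sip_linr hip)// (sip_sym hip Dg D0) (sip0l hip)// addr0.
Qed.

Lemma qpoly_orthogonal m n : (0 < m)%N -> (0 < n)%N -> m != n ->
  L2ip (w b a) (horner (qpoly m)) (horner (qpoly n)) = 0.
Proof.
move=> m0 n0 mn; have Dq k := poly_in_L2_w b1 a1 (qpoly k).
rewrite L2ip_qpolyl// (sip_sym hip)// L2ip_qpolyl//.
have := L2ip_onem2 (sjpoly (a + 2) b n.-1) m.-1.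
rewrite -sjacobi_horner => ->; rewrite sjacobi_orthogonal ?mulr0//.
by apply: contra mn => /eqP h; rewrite -(prednK m0) -(prednK n0) h.
Qed.

(** Pairing with a polynomial only sees its value at the corner: the rest of
    it carries a factor [1 - x], and two such factors change the weight into the
    one for which the Jacobi factor of [qpoly] is orthogonal to lower degrees.
    The normalisation of [qpoly] makes the answer independent of [b]. *)
Lemma L2ip_qpoly p m : (size p <= m)%N -> (0 < m)%N ->
  cw b a * L2ip (w b a) (horner p) (horner (qpoly m)) = p.[1] * (a + 1).
Proof.
case: m => // m sp _; have ha := a1; have hb := b1.
have [r pr] : exists r, p - p.[1]%:P = r * ('X - 1%:P).
  by apply/factor_theorem; rewrite /root !hornerE subrr.
have sr : (size r <= m)%N.
  have [->|r0] := eqVneq r 0; first by rewrite size_poly0.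
  have := size_Mmonic r0 (monicXsubC 1); rewrite size_XsubC addn2 -pr /= => e.
  rewrite -ltnS -e (leq_trans (size_polyD _ _))// size_polyN geq_max sp.
  by rewrite (leq_trans (size_polyC_leq1 _)).
have Dr : in_L2 (w b a) (fun x => (1 - x) * r.[x]).
  have := poly_in_L2_w b1 a1 ((1 - 'X) * r).
  by congr in_L2; apply/funext => x; rewrite hornerM !hornerE.
have D1 : in_L2 (w b a) (fun=> 1).
  have := poly_in_L2_w b1 a1 1.
  by congr in_L2; apply/funext => x; rewrite hornerE.
have Dp := poly_in_L2_w b1 a1.
have pE : horner p = (fun x => -1 * ((1 - x) * r.[x]) + (p.[1] * 1 + 0)).
  apply/funext => x; transitivity ((r * ('X - 1%:P) + p.[1]%:P).[x]).
    by rewrite -pr subrK.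
  by rewrite hornerD hornerM hornerXsubC hornerC; ring.
have D0 := sip_dom0 hip; have Dc := sip_domD hip p.[1] D1 D0.
rewrite L2ip_qpolyl// pE (sip_lin hip)// (sip_lin hip)// (sip0l hip)// addr0.
rewrite L2ip_onem2 L2ip_lowdeg//= mulr0 add0r.
have -> : L2ip (w b a) (fun=> 1) (fun x => (1 - x) * sjacobi (a + 2) b m x) =
    \int[mu]_(x in I01) (sjacobi (a + 2) b m x * w b (a + 2 - 1) x).
  apply: eq_Rintegral => x /set_mem /=; rewrite in_itv /= => /andP[_ x1].
  have -> : a + 2 - 1 = a + 1%:R by ring.
  by rewrite w_shift// expr1; ring.
rewrite jacobi_moment_lower//; last by lra.
have -> : a + 2 - 1 = a + 1 by ring.
have M0 := beta_int_gt0 b1 a1; have := beta_int_rec b1 a1.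
have s0 : 0 < a + b + 2 by lra.
rewrite /cw -/(beta_int b a) /qcoef /= pochSl.
have -> : a + 2 + b + 1 = a + b + 2 + 1 by ring.
have A1 : 0 < poch (b + 1) m by apply: poch_gt0; lra.
have A2 : 0 < poch (a + b + 2 + 1) m by apply: poch_gt0; lra.
move=> rec; rewrite [LHS](_ : _ = p.[1] / beta_int b a *
  ((a + b + 2) * beta_int b (a + 1))); last by field; rewrite !gt_eqF.
by rewrite rec; field; rewrite gt_eqF.
Qed.

End CornerPolynomials.

Section WedgeSeries.
Context {R : realType}.
Local Notation mu := (@lebesgue_measure R).
Local Notation I01 := (`[0%R, 1%R]%classic : set R).
Variables (alpha beta gamma sigma : R).
Hypotheses (halpha : -1 < alpha) (hbeta : -1 < beta) (hgamma : -1 < gamma).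
Hypothesis hsigma : 0 < sigma.
Implicit Types (f g r : R * R -> R) (h : {poly R}) (m n k : nat).

Local Notation v1 := (w alpha gamma).
Local Notation v2 := (w beta gamma).
Local Notation ip := (ipO alpha beta gamma sigma).
Local Notation P := (PO alpha beta gamma).
Local Notation Q := (QO alpha beta gamma sigma).
Local Notation RR := (RO alpha beta gamma sigma).

Definition wedge_L2 f := in_L2 v1 (trace1 f) /\ in_L2 v2 (trace2 f).

Lemma ipOE f g : ip f g = cw alpha gamma * L2ip v1 (trace1 f) (trace1 g) +
  sigma * cw beta gamma * L2ip v2 (trace2 f) (trace2 g).
Proof. by []. Qed.

Lemma cw_gt0 b : -1 < b -> 0 < cw b gamma.
Proof. by move=> hb; rewrite invr_gt0; exact: beta_int_gt0. Qed.

Let h1 := L2_semi_inner_product (w_ge0 alpha gamma) (integrable_w halpha hgamma).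
Let h2 := L2_semi_inner_product (w_ge0 beta gamma) (integrable_w hbeta hgamma).

Lemma ipO_semi_inner_product : semi_inner_product wedge_L2 ip.
Proof.
have c1 := cw_gt0 halpha; have c2 := cw_gt0 hbeta.
split.
- by split; [exact: sip_dom0 h1|exact: sip_dom0 h2].
- move=> a f g [f1 f2] [g1 g2]; split.
    exact: (sip_domD h1 a f1 g1).
  exact: (sip_domD h2 a f2 g2).
- by move=> f g [f1 f2] [g1 g2]; rewrite !ipOE (sip_sym h1 f1 g1) (sip_sym h2 f2 g2).
- move=> a f g h [f1 f2] [g1 g2] [hh1 hh2]; rewrite !ipOE.
  transitivity (cw alpha gamma * L2ip v1 (fun x => a * trace1 f x + trace1 g x) (trace1 h) +
    sigma * cw beta gamma * L2ip v2 (fun x => a * trace2 f x + trace2 g x) (trace2 h)) => //.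
  rewrite (sip_lin h1 a f1 g1 hh1) (sip_lin h2 a f2 g2 hh2).
  move: (L2ip v1 _ _) (L2ip v1 _ _) (L2ip v2 _ _) (L2ip v2 _ _) => x1 x2 y1 y2.
  by ring.
- move=> f [f1 f2]; rewrite ipOE addr_ge0// mulr_ge0//.
  + exact: ltW.
  + exact: sip_ge0 h1 _ f1.
  + by rewrite mulr_ge0// ltW.
  + exact: sip_ge0 h2 _ f2.
Qed.

Let hO := ipO_semi_inner_product.

Lemma trace1_PO n : trace1 (P n) = horner (sjpoly gamma alpha n).
Proof.
by apply/funext => x; rewrite /trace1 /PO /= sjacobi1 addrK horner_sjpoly.
Qed.

Lemma trace2_PO n : trace2 (P n) = horner (sjpoly gamma beta n).
Proof.
apply/funext => x; rewrite /trace2 /PO /= sjacobi1 horner_sjpoly.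
by rewrite addrAC subrr add0r.
Qed.

Lemma trace1_QO n : trace1 (Q n) = horner (qpoly alpha gamma n).
Proof.
by apply/funext => x; rewrite /trace1 /QO /= horner_qpoly subrr mulr0 mul0r subr0.
Qed.

Lemma trace2_QO n : trace2 (Q n) = horner (- sigma^-1 *: qpoly beta gamma n).
Proof.
apply/funext => x; rewrite /trace2 /QO /= hornerZ horner_qpoly subrr mulr0 mul0r.
by rewrite /qcoef; ring.
Qed.

Lemma PO_in_L2 n : wedge_L2 (P n).
Proof. by rewrite /wedge_L2 trace1_PO trace2_PO; split; exact: poly_in_L2_w. Qed.

Lemma QO_in_L2 n : wedge_L2 (Q n).
Proof. by rewrite /wedge_L2 trace1_QO trace2_QO; split; exact: poly_in_L2_w. Qed.

Let ROE n : RR n = (fun p => - (ip (P n) (Q n) / ip (P n) (P n)) * P n p + Q n p).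
Proof. by apply/funext => p; rewrite /RO addrC mulNr. Qed.

Lemma RO_in_L2 n : wedge_L2 (RR n).
Proof. by rewrite ROE; exact: (sip_domD hO _ (PO_in_L2 n) (QO_in_L2 n)). Qed.

Lemma PO_orthogonal m n : m != n -> ip (P m) (P n) = 0.
Proof.
move=> mn; rewrite ipOE !trace1_PO !trace2_PO -!sjacobi_horner.
by rewrite !sjacobi_orthogonal// !mulr0 addr0.
Qed.

(** For [m < n] both edges contribute the common value at the corner times
    [gamma + 1], with opposite signs; for [n < m] each contribution is 0. *)
Lemma PO_QO_orthogonal m n : m != n -> (0 < n)%N -> ip (P m) (Q n) = 0.
Proof.
rewrite neq_ltn ipOE trace1_PO trace2_PO trace1_QO trace2_QO => mn n0.
have D0 := sip_dom0 h2; have Dp q := poly_in_L2_w hbeta hgamma q.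
have -> : L2ip v2 (horner (sjpoly gamma beta m))
      (horner (- sigma^-1 *: qpoly beta gamma n)) =
    - sigma^-1 * L2ip v2 (horner (sjpoly gamma beta m)) (horner (qpoly beta gamma n)).
  have := sip_linr h2 (- sigma^-1) (Dp (qpoly beta gamma n)) D0 (Dp (sjpoly gamma beta m)).
  rewrite (sip_sym h2 (Dp _) D0) (sip0l h2 (Dp _)) addr0 => <-.
  by congr L2ip; apply/funext => x; rewrite hornerZ addr0.
have -> A B : cw alpha gamma * A + sigma * cw beta gamma * (- sigma^-1 * B) =
    cw alpha gamma * A - cw beta gamma * B.
  by field; rewrite gt_eqF.
case/orP : mn => [mn|nm].
  rewrite !L2ip_qpoly ?(leq_trans (size_sjpoly _ _ _) mn)//.
  by rewrite !horner_sjpoly !sjacobi1 subrr.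
have sz b : (size (qpoly b gamma n) <= m)%N.
  exact: leq_trans (size_qpoly _ _ n0) nm.
rewrite (sip_sym h1); try exact: poly_in_L2_w.
rewrite (sip_sym h2); try exact: poly_in_L2_w.
by rewrite -!sjacobi_horner !L2ip_lowdeg// !mulr0 subrr.
Qed.

Lemma QO_orthogonal m n : (0 < m)%N -> (0 < n)%N -> m != n -> ip (Q m) (Q n) = 0.
Proof.
move=> m0 n0 mn; rewrite ipOE !trace1_QO !trace2_QO.
have D0 := sip_dom0 h2; have Dp q := poly_in_L2_w hbeta hgamma q.
have Z q : horner (- sigma^-1 *: q) = (fun x => - sigma^-1 * q.[x] + 0).
  by apply/funext => x; rewrite hornerZ addr0.
rewrite !Z (sip_lin h2)//; last by rewrite -Z.
rewrite (sip_linr h2)// -!Z (sip0l h2)// (sip_sym h2 (Dp _) D0) (sip0l h2)//.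
by rewrite !qpoly_orthogonal// !(mulr0, addr0).
Qed.

Lemma PO_RO_orthogonal m n : (0 < n)%N -> ip (P m) (RR n) = 0.
Proof.
move=> n0; have DP := PO_in_L2; have DQ := QO_in_L2.
rewrite ROE (sip_linr hO)//; have [->|mn] := eqVneq m n.
  by rewrite mulNr (sip_sym hO (DP n) (DQ n)) (sip_coefK hO)// addNr.
by rewrite (PO_orthogonal mn) (PO_QO_orthogonal mn n0) mulr0 addr0.
Qed.

Lemma RO_orthogonal m n : (0 < m)%N -> (0 < n)%N -> m != n -> ip (RR m) (RR n) = 0.
Proof.
move=> m0 n0 mn; have DP := PO_in_L2; have DQ := QO_in_L2; have DR := RO_in_L2.
rewrite {1}ROE (sip_lin hO)// PO_RO_orthogonal// mulr0 add0r.
rewrite ROE (sip_linr hO)// QO_orthogonal// addr0.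
have nm : n != m by rewrite eq_sym.
by rewrite (sip_sym hO (DQ m) (DP n)) (PO_QO_orthogonal nm m0) mulr0.
Qed.

(** Pairs [(k, false)] index the [P k], with [P 0 = 1], and [(k, true)] the [R_k]. *)
Definition wedge_basis (i : nat * bool) := if i.2 then RR i.1 else P i.1.

Definition wedge_index n : seq (nat * bool) :=
  [seq (k, false) | k <- iota 0 n.+1] ++ [seq (k, true) | k <- iota 1 n].

Lemma wedge_basis_in_L2 i : wedge_L2 (wedge_basis i).
Proof. by case: i => k [|]; [exact: RO_in_L2|exact: PO_in_L2]. Qed.

Lemma uniq_wedge_index n : uniq (wedge_index n).
Proof.
rewrite cat_uniq !map_inj_uniq ?iota_uniq; try by move=> ? ? [].
rewrite andbT; apply/hasPn => _ /mapP[k _ ->].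
by apply/mapP => -[j _ []].
Qed.

Lemma mem_wedge_index n k c :
  ((k, c) \in wedge_index n) = if c then (0 < k <= n)%N else (k <= n)%N.
Proof.
rewrite mem_cat; case: c.
  rewrite (_ : _ \in map _ _ = false); last by apply/negbTE/mapP => -[j _ []].
  rewrite mem_map ?mem_iota ?add1n ?ltnS//; by move=> ? ? [].
rewrite orbC (_ : _ \in map _ _ = false); last by apply/negbTE/mapP => -[j _ []].
rewrite mem_map ?mem_iota ?add0n ?ltnS//; by move=> ? ? [].
Qed.

Lemma wedge_basis_orthogonal n i j : i \in wedge_index n -> j \in wedge_index n ->
  j != i -> ip (wedge_basis j) (wedge_basis i) = 0.
Proof.
case: i j => [i c] [j d]; rewrite !mem_wedge_index.
have DP := PO_in_L2; have DR := RO_in_L2.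
rewrite /wedge_basis; case: c d => [] [] /= hi hj ji.
- apply: RO_orthogonal; first by case/andP: hj.
    by case/andP: hi.
  by apply: contra ji => /eqP /= ->.
- by apply: PO_RO_orthogonal; case/andP: hi.
- by rewrite (sip_sym hO)//; apply: PO_RO_orthogonal; case/andP: hj.
- by apply: PO_orthogonal; apply: contra ji => /eqP /= ->.
Qed.

Lemma oneO_PO : @oneO R = P 0.
Proof.
apply/funext => p; rewrite /oneO /PO /sjacobi /jacobi !big_ord1 !expr0.
by rewrite !subnn !poch0 fact0 /gbinom big_ord0 fact0 !hornerZ !hornerE; field.
Qed.

Lemma psumOE n f : psumO alpha beta gamma sigma n f =
  (fun p => \sum_(i <- wedge_index n)
     ip f (wedge_basis i) / ip (wedge_basis i) (wedge_basis i) * wedge_basis i p).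
Proof.
apply/funext => p; rewrite /psumO big_split /= addrA big_cat /= !big_map /=.
congr (_ + _); last by rewrite /index_iota subSS subn0.
rewrite big_cons oneO_PO; congr (_ + _); last by rewrite big_map /index_iota subSS subn0.
by rewrite /wedge_basis /= -oneO_PO /oneO mulr1.
Qed.

Section Residual.
Variables (f : R * R -> R) (n : nat).
Hypothesis Df : wedge_L2 f.

Let S := psumO alpha beta gamma sigma n f.
Let r := (fun p => f p - S p).

Lemma psumO_in_L2 : wedge_L2 S.
Proof. by rewrite /S psumOE; apply: (sip_dom_sum hO); exact: wedge_basis_in_L2. Qed.

Let Dr : wedge_L2 r. Proof. exact: (sip_domB hO Df psumO_in_L2). Qed.

Let residual_basis i : i \in wedge_index n -> ip r (wedge_basis i) = 0.
Proof.
move=> ir; rewrite /r /S psumOE.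
apply: (sip_fourier_residual hO wedge_basis_in_L2 (uniq_wedge_index n) Df) => //.
by move=> j jr; exact: wedge_basis_orthogonal ir jr.
Qed.

Let residual_psum : ip r S = 0.
Proof.
rewrite (sip_sym hO Dr psumO_in_L2) /S psumOE.
rewrite (sip_sum hO wedge_basis_in_L2)// big_seq big1// => i ir.
by rewrite (sip_sym hO (wedge_basis_in_L2 i) Dr) residual_basis// mulr0.
Qed.

Let residual_P k : (k <= n)%N -> ip r (P k) = 0.
Proof. by move=> kn; apply: (residual_basis (i := (k, false))); rewrite mem_wedge_index. Qed.

Let residual_Q k : (0 < k <= n)%N -> ip r (Q k) = 0.
Proof.
move=> kn; have DP := PO_in_L2; have DQ := QO_in_L2.
have := residual_basis (i := (k, true)); rewrite mem_wedge_index => /(_ kn).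
rewrite /wedge_basis /= ROE (sip_linr hO)// residual_P ?mulr0 ?add0r//.
by case/andP: kn.
Qed.

Definition glue (p q : {poly R}) (z : R * R) := p.[z.1] + q.[z.2] - p.[1].

Lemma trace1_glue p q : p.[1] = q.[1] -> trace1 (glue p q) = horner p.
Proof. by move=> pq; apply/funext => x; rewrite /trace1 /glue /= pq addrK. Qed.

Lemma trace2_glue p q : trace2 (glue p q) = horner q.
Proof. by apply/funext => x; rewrite /trace2 /glue /= addrAC subrr add0r. Qed.

Lemma glue_in_L2 p q : p.[1] = q.[1] -> wedge_L2 (glue p q).
Proof.
by move=> pq; rewrite /wedge_L2 trace1_glue// trace2_glue; split; exact: poly_in_L2_w.
Qed.

(** Pairs of polynomials agreeing at the corner are spanned by the [P k] and
    [Q k]: the leading coefficients of [P k] on the two edges have the same sign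
    and those of [Q k] opposite signs, so that top degrees can be cancelled. *)
Let residual_glue (p q : {poly R}) : (size p <= n.+1)%N -> (size q <= n.+1)%N ->
  p.[1] = q.[1] -> ip r (glue p q) = 0.
Proof.
suff H m : (m <= n)%N -> forall p q : {poly R}, (size p <= m.+1)%N -> (size q <= m.+1)%N ->
  p.[1] = q.[1] -> ip r (glue p q) = 0 by exact: H.
have DP := PO_in_L2; have DQ := QO_in_L2.
elim: m => [_|m IH mn] {}p {}q sp sq pq.
  have hp y : p.[y] = p`_0 by rewrite {1}(size1_polyC sp) hornerC.
  have hq y : q.[y] = q`_0 by rewrite {1}(size1_polyC sq) hornerC.
  have D0 := sip_dom0 hO.
  have := sip_linr hO p`_0 (DP 0%N) D0 Dr.
  rewrite residual_P// (sip_sym hO Dr D0) (sip0l hO Dr) mulr0 addr0 => <-.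
  rewrite -oneO_PO; congr ip; apply/funext => z.
  by rewrite /glue /oneO addr0 mulr1 !hp hq -(hq 1) -pq hp addrK.
pose k := m.+1.
pose p1 := (sjpoly gamma alpha k)`_k; pose p2 := (sjpoly gamma beta k)`_k.
pose q1 := (qpoly alpha gamma k)`_k; pose q2 := - sigma^-1 * (qpoly beta gamma k)`_k.
have p10 : 0 < p1 by rewrite /p1 coef_sjpoly jcoef_diag_gt0.
have p20 : 0 < p2 by rewrite /p2 coef_sjpoly jcoef_diag_gt0.
have q10 : q1 < 0 by exact: coef_qpoly_lt0.
have q20 : 0 < q2.
  by rewrite /q2 mulNr oppr_gt0 pmulr_rlt0 ?invr_gt0//; exact: coef_qpoly_lt0.
have det0 : p1 * q2 - p2 * q1 != 0.
  by rewrite gt_eqF// subr_gt0 (lt_trans (y := 0))// ?pmulr_rlt0// mulr_gt0.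
pose x := (p`_k * q2 - q`_k * q1) / (p1 * q2 - p2 * q1).
pose y := (q`_k * p1 - p`_k * p2) / (p1 * q2 - p2 * q1).
pose p' := p - x *: sjpoly gamma alpha k - y *: qpoly alpha gamma k.
pose q' := q - x *: sjpoly gamma beta k - y *: (- sigma^-1 *: qpoly beta gamma k).
have sz (u u1 u2 : {poly R}) : (size u <= k.+1)%N -> (size u1 <= k.+1)%N ->
    (size u2 <= k.+1)%N -> u`_k = x * u1`_k + y * u2`_k ->
    (size (u - x *: u1 - y *: u2)%R <= m.+1)%N.
  move=> su su1 su2 e; apply/leq_sizeP => j; rewrite leq_eqVlt !(coefB, coefZ).
  move=> /predU1P[<-|kj]; first by rewrite -/k e; ring.
  rewrite (nth_default 0 (leq_trans su kj)) (nth_default 0 (leq_trans su1 kj)).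
  by rewrite (nth_default 0 (leq_trans su2 kj)) !mulr0 !subr0.
have hE (u u1 u2 : {poly R}) z :
    (u - x *: u1 - y *: u2).[z] = u.[z] - x * u1.[z] - y * u2.[z].
  by rewrite !(hornerD, hornerN, hornerZ).
have sp' : (size p' <= m.+1)%N.
  apply: sz => //; [exact: size_sjpoly|exact: size_qpoly|].
  by rewrite -/p1 -/q1 /x /y; field.
have sq' : (size q' <= m.+1)%N.
  apply: sz => //; [exact: size_sjpoly| |].
    by rewrite (leq_trans (size_scale_leq _ _))// size_qpoly.
  by rewrite coefZ -/p2 -/q2 /x /y; field.
have e1 : p'.[1] = q'.[1].
  rewrite /p' /q' !hE (hornerZ (- sigma^-1)) !horner_qpoly !horner_sjpoly.
  by rewrite !sjacobi1 pq subrr !(mulr0, mul0r).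
have DG := glue_in_L2 e1.
have := sip_linr hO x (DP k) (sip_domD hO y (DQ k) DG) Dr.
rewrite (sip_linr hO y (DQ k) DG Dr) residual_P// residual_Q//.
rewrite (IH (ltnW mn) _ _ sp' sq' e1) !mulr0 !addr0 => <-.
have ext g1 g2 : trace1 g1 = trace1 g2 -> trace2 g1 = trace2 g2 -> ip r g1 = ip r g2.
  by move=> t1 t2; rewrite !ipOE t1 t2.
apply: ext; rewrite ?trace1_glue ?trace2_glue//; apply/funext => z.
  rewrite -[RHS]/(x * trace1 (P k) z + (y * trace1 (Q k) z + trace1 (glue p' q') z)).
  rewrite trace1_PO trace1_QO trace1_glue// /p' hE; ring.
rewrite -[RHS]/(x * trace2 (P k) z + (y * trace2 (Q k) z + trace2 (glue p' q') z)).
rewrite trace2_PO trace2_QO trace2_glue /q' hE; ring.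
Qed.

Lemma psumO_best_approximation (p q : {poly R}) : (size p <= n.+1)%N -> (size q <= n.+1)%N ->
  p.[1] = q.[1] ->
  ip (fun z => f z - S z) (fun z => f z - S z) <=
  ip (fun z => f z - glue p q z) (fun z => f z - glue p q z).
Proof.
move=> sp sq pq; have DG := glue_in_L2 pq; have DS := psumO_in_L2.
apply: (sip_best_approximation hO) => //.
rewrite (sip_sym hO (sip_domB hO Df DS) (sip_domB hO DG DS)) (sip_subl hO)//.
rewrite (sip_sym hO DG Dr) (sip_sym hO DS Dr).
by rewrite residual_glue// residual_psum subrr.
Qed.

End Residual.

End WedgeSeries.

(** * The error bound and convergence *)

Lemma in_L2O_traces (R : realType) (alpha beta gamma sigma : R) (f : R * R -> R) :
  -1 < alpha -> -1 < beta -> -1 < gamma -> 0 < sigma ->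
  in_L2O alpha beta gamma sigma f ->
  in_L2 (w alpha gamma) (trace1 f) /\ in_L2 (w beta gamma) (trace2 f).
Proof.
move=> ha hb hg hs [m1 m2].
have c1 := cw_gt0 hg ha; have c2 := cw_gt0 hg hb.
have nonneg b (g : R -> R) : (0 <= \int[@lebesgue_measure R]_(x in `[0%R, 1%R])
    (g x * g x * w b gamma x)%:E)%E.
  by apply: integral_ge0 => x _; rewrite lee_fin mulr_ge0 ?w_ge0// -expr2 sqr_ge0.
have fin (c : R) (y z : \bar R) : 0 < c -> (0 <= y)%E -> (0 <= z)%E ->
    (c%:E * y + z < +oo)%E -> (y < +oo)%E.
  move=> c0 y0 z0 h; rewrite ltey; apply/eqP => yE; move: h.
  by rewrite yE gt0_muley ?lte_fin// addye// gt_eqF// (lt_le_trans _ z0)// ltNy0.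
have sq b (g : R -> R) : (\int[@lebesgue_measure R]_(x in `[0%R, 1%R])
    (`|g x| ^+ 2 * w b gamma x)%:E = \int[@lebesgue_measure R]_(x in `[0%R, 1%R])
    (g x * g x * w b gamma x)%:E)%E.
  by apply: eq_integral => x _; rewrite real_normK ?num_real// expr2.
move=> h; split; split=> //; rewrite sq.
  apply: (fin _ _ _ c1 _ _ h); first exact: (nonneg alpha (trace1 f)).
  apply: mule_ge0; last exact: (nonneg beta (trace2 f)).
  by rewrite lee_fin mulr_ge0 ?ltW.
rewrite addeC in h.
apply: (fin _ _ _ (mulr_gt0 hs c2) _ _ h); first exact: (nonneg beta (trace2 f)).
apply: mule_ge0; last exact: (nonneg alpha (trace1 f)).
by rewrite lee_fin ltW.
Qed.

Lemma sqrt_sum4_le (R : rcfType) (x y z t : R) :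
  0 <= x -> 0 <= y -> 0 <= z -> 0 <= t ->
  Num.sqrt (x ^+ 2 + y ^+ 2 + (z ^+ 2 + t ^+ 2)) <= x + y + (z + t).
Proof.
move=> x0 y0 z0 t0.
rewrite -[leRHS]ger0_norm ?addr_ge0// -sqrtr_sqr; apply: ler_wsqrtr.
have := mulr_ge0 x0 y0; have := mulr_ge0 x0 z0; have := mulr_ge0 x0 t0.
have := mulr_ge0 y0 z0; have := mulr_ge0 y0 t0; have := mulr_ge0 z0 t0.
by move=> *; nra.
Qed.

Lemma sum_mul_le (R : realFieldType) (k l x y : R) :
  0 < k -> 0 < l -> 0 <= x -> 0 <= y -> k * x + l * y <= (k + l) * (x + y).
Proof. by move=> *; nra. Qed.

(** On each edge there is a good polynomial with the value [f (1, 1)] at the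
    corner; the two fit together and the partial sum does at least as well. *)
Lemma wedge_error_bound (R : realType) (alpha beta gamma sigma : R) :
  -1 < alpha -> -1 < beta -> -1 < gamma -> 0 < sigma ->
  exists c : R, 0 < c /\
     forall f : R * R -> R,
       in_L2 (w alpha gamma) (trace1 f) ->
       in_L2 (w beta gamma) (trace2 f) ->
     forall n : nat,
       normO alpha beta gamma sigma
         (fun p => f p - psumO alpha beta gamma sigma n f p)
       <= c * (L2norm (w alpha gamma)
                 (fun x => trace1 f x - psum1 alpha gamma n (trace1 f) x) +
               L2norm (w beta gamma)
                 (fun y => trace2 f y - psum1 beta gamma n (trace2 f) y)) +
          c * (L2norm (w alpha (gamma + 2))
                 (fun x => quot1 f x - psum1 alpha (gamma + 2) n (quot1 f) x) +
               L2norm (w beta (gamma + 2))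
                 (fun y => quot2 f y - psum1 beta (gamma + 2) n (quot2 f) y)).
Proof.
move=> ha hb hg hs.
have c1 := cw_gt0 hg ha; have c2 := mulr_gt0 hs (cw_gt0 hg hb).
have [C1 C10 e1] := edge_approximation ha hg.
have [C2 C20 e2] := edge_approximation hb hg.
pose K := cw alpha gamma * C1 + sigma * cw beta gamma * C2.
have K1 := mulr_gt0 c1 C10; have K2 := mulr_gt0 c2 C20.
have K0 : 0 < K by rewrite addr_gt0.
exists (Num.sqrt K); split; first by rewrite sqrtr_gt0.
move=> f f1 f2 n; rewrite -mulrDr.
have [p [sp p1 ep]] := e1 _ f1 n; have [q [sq q1 eq]] := e2 _ f2 n.
have pq : p.[1] = q.[1] by rewrite p1 q1.
rewrite -[quot1 f]/(quot (trace1 f)) -[quot2 f]/(quot (trace2 f)).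
move: ep eq; set a1 := L2norm (w alpha gamma) _; set a2 := L2norm (w beta gamma) _.
set g1 := L2norm (w alpha (gamma + 2)) _; set g2 := L2norm (w beta (gamma + 2)) _.
move=> ep eq.
have := sqrt_sum4_le (sqrtr_ge0 _ : 0 <= a1) (sqrtr_ge0 _ : 0 <= a2)
  (sqrtr_ge0 _ : 0 <= g1) (sqrtr_ge0 _ : 0 <= g2).
move=> /(ler_wpM2l (sqrtr_ge0 K)); apply: le_trans.
rewrite /normO -(sqrtrM _ (ltW K0)); apply: ler_wsqrtr.
apply: (le_trans (psumO_best_approximation ha hb hg hs (conj f1 f2) sp sq pq)).
rewrite ipOE.
rewrite (_ : trace1 (fun z => _) = (fun x => trace1 f x - p.[x])); last first.
  by rewrite -(trace1_glue pq).
rewrite (_ : trace2 (fun z => _) = (fun x => trace2 f x - q.[x])); last first.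
  by rewrite -(trace2_glue p q).
have {}ep := ler_wpM2l (ltW c1) ep; have {}eq := ler_wpM2l (ltW c2) eq.
apply: (le_trans (lerD ep eq)).
have s1 : 0 <= a1 ^+ 2 + g1 ^+ 2 by rewrite addr_ge0 ?sqr_ge0.
have s2 : 0 <= a2 ^+ 2 + g2 ^+ 2 by rewrite addr_ge0 ?sqr_ge0.
rewrite !mulrA addrACA.
exact: (sum_mul_le K1 K2 s1 s2).
Qed.

Theorem theorem2p9 (R : realType) (alpha beta gamma sigma : R)
    (halpha : -1 < alpha) (hbeta : -1 < beta) (hgamma : -1 < gamma)
    (hsigma : 0 < sigma) :
  (forall f : R * R -> R, in_L2O alpha beta gamma sigma f ->
     normO alpha beta gamma sigma
       (fun p => f p - psumO alpha beta gamma sigma n f p) @[n --> \oo]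
     --> (0 : R))
  /\
  (exists c : R, 0 < c /\
     forall f : R * R -> R,
       in_L2 (w alpha gamma) (trace1 f) ->
       in_L2 (w beta gamma) (trace2 f) ->
     forall n : nat,
       normO alpha beta gamma sigma
         (fun p => f p - psumO alpha beta gamma sigma n f p)
       <= c * (L2norm (w alpha gamma)
                 (fun x => trace1 f x - psum1 alpha gamma n (trace1 f) x) +
               L2norm (w beta gamma)
                 (fun y => trace2 f y - psum1 beta gamma n (trace2 f) y)) +
          c * (L2norm (w alpha (gamma + 2))
                 (fun x => quot1 f x - psum1 alpha (gamma + 2) n (quot1 f) x) +
               L2norm (w beta (gamma + 2))
                 (fun y => quot2 f y - psum1 beta (gamma + 2) n (quot2 f) y))).
Proof.
have hgamma2 : -1 < gamma + 2 by lra.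
have bound := wedge_error_bound halpha hbeta hgamma hsigma.
split=> // f Df; case: bound => c [_ bound].
have [f1 f2] := in_L2O_traces halpha hbeta hgamma hsigma Df.
have g1 := quot_in_L2 halpha hgamma f1; have g2 := quot_in_L2 hbeta hgamma f2.
have cf1 := jacobi_series_cvg halpha hgamma f1.
have cf2 := jacobi_series_cvg hbeta hgamma f2.
have cg1 := jacobi_series_cvg halpha hgamma2 g1.
have cg2 := jacobi_series_cvg hbeta hgamma2 g2.
have cb := cvgD (cvgMr (a := c) (cvgD cf1 cf2)) (cvgMr (a := c) (cvgD cg1 cg2)).
rewrite !addr0 mulr0 addr0 in cb.
apply: (squeeze_cvgr _ (cvg_cst 0) (cb _ _ _ _ _)).
by apply: nearW => n; apply/andP; split; [exact: sqrtr_ge0|exact: bound].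
Qed.
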